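(* Let $G$ be a discrete group. If $G=A\rtimes B$ is a semidirect product of groups $A$ and $B$, then $\mathsf{TC}(G)\ge \mathrm{cd}(A\times B)$.
   Context: All spaces are assumed to have the homotopy type of a CW complex. For a continuous map $p\colon E\to Z$, the sectional category $\mathsf{secat}(p)$ is the least integer $k$ for which $Z$ admits a cover by $k+1$ open sets $U_0,\ldots,U_k$ on each of which there is a continuous map $s_i\colon U_i\to E$ such that $p\circ s_i$ is homotopic to the inclusion $U_i\hookrightarrow Z$; if no such integer exists, $\mathsf{secat}(p)=\infty$. (When $p$ is a Hurewicz fibration, one may equivalently require $p\circ s_i$ to equal the inclusion.) For a space $X$, let $X^I$ be the space of all paths $\gamma\colon[0,1]\to X$ with the compact-open topology, and let $\pi_X\colon X^I\to X\times X$, $\pi_X(\gamma)=(\gamma(0),\gamma(1))$, be the free path fibration. The (normalized) topological complexity of $X$ is $\mathsf{TC}(X):=\mathsf{secat}(\pi_X)$, so contractible spaces have $\mathsf{TC}=0$. For a discrete group $G$, $\mathsf{TC}(G):=\mathsf{TC}(K(G,1))$, where $K(G,1)$ is an aspherical connected CW complex with fundamental group $G$ (unique up to homotopy equivalence; $\mathsf{TC}$ is a homotopy invariant). The cohomological dimension $\mathrm{cd}(G)$ of a group $G$ is the least integer $k$ such that $H^i(G;M)=0$ for all $i>k$ and all $\mathbb{Z}[G]$-modules $M$; if no such integer exists, $\mathrm{cd}(G)=\infty$. $A\times B$ denotes the (external) direct product of groups. *)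

(* Defs.v *)
From HB Require Import structures.
From mathcomp Require Import all_boot all_order all_algebra.
From mathcomp Require Import all_classical all_reals all_analysis.
Import numFieldNormedType.Exports.

Set Implicit Arguments.
Unset Strict Implicit.
Unset Printing Implicit Defensive.

Import Order.TTheory GRing.Theory Num.Theory.
Local Open Scope classical_set_scope.
Local Open Scope ring_scope.

(* The least element of a set of natural numbers, as an extended real: the
   infimum of a nonempty [P] is attained, and [ereal_inf set0 = +oo]. *)
Definition least {R : realType} (P : set nat) : \bar R :=
  ereal_inf [set (k%:R)%:E | k in P].

(* A (left) Z[G]-module is an abelian group on which G acts by additive maps. *)
Record gmodule (G : groupType) := GModule {
  gmod_sort :> zmodType;
  gact : G -> gmod_sort -> gmod_sort;
  gact1 : forall m, gact 1%g m = m;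
  gactM : forall g h m, gact (g * h)%g m = gact g (gact h m);
  gactD : forall g m m', gact g (m + m') = gact g m + gact g m'
}.

Section Cohomology.
Variables (G : groupType) (M : gmodule G).

(* [equivariant f] says that [f] is an element of
   Hom_{Z[G]}(Z[G^(n+1)], M), where the Z[G^(n+1)] with the diagonal action
   form the standard free resolution of Z. *)
Definition equivariant (n : nat) (f : ('I_n.+1 -> G) -> M) : Prop :=
  forall (h : G) (g : 'I_n.+1 -> G),
    f (fun i => (h * g i)%g) = gact h (f g).

(* [g \o lift i] is the tuple [g] with its i-th entry removed. *)
Definition codiff (n : nat) (f : ('I_n.+1 -> G) -> M) :
    ('I_n.+2 -> G) -> M :=
  fun g => \sum_(i < n.+2) f (g \o lift i) *~ ((-1) ^+ i).

Definition cocycle (n : nat) (f : ('I_n.+1 -> G) -> M) : Prop :=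
  equivariant f /\ forall g, codiff f g = 0.

Definition coboundary (n : nat) : (('I_n.+1 -> G) -> M) -> Prop :=
  match n with
  | 0 => fun f => forall g, f g = 0
  | m.+1 => fun f => exists2 e : ('I_m.+1 -> G) -> M,
      equivariant e & forall g, f g = codiff e g
  end.

Definition cohomology_trivial (n : nat) : Prop :=
  forall f : ('I_n.+1 -> G) -> M, cocycle f -> coboundary f.

End Cohomology.

Definition cd {R : realType} (G : groupType) : \bar R :=
  least [set k | forall i, (k < i)%N ->
                 forall M : gmodule G, cohomology_trivial M i].

Definition I01 (R : realType) : topologicalType := set_type `[0 : R, 1].

Lemma clip_subproof (R : realType) (t : R) :
  Num.max 0 (Num.min 1 t) \in `[0 : R, 1]%classic.
Proof. by rewrite inE /= in_itv /= le_max lexx ge_max ler01 ge_min lexx. Qed.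

Definition clip {R : realType} (t : R) : I01 R :=
  @exist R (fun u => u \in `[0 : R, 1]%classic) _ (clip_subproof t).

Definition homotopic_rel (R : realType) {X Y : topologicalType} (A : set X)
    (f g : X -> Y) : Prop :=
  exists H : X * I01 R -> Y,
    [/\ continuous H,
        forall x, H (x, clip 0) = f x,
        forall x, H (x, clip 1) = g x &
        forall x s, A x -> H (x, s) = f x].

Definition homotopic (R : realType) {X Y : topologicalType} (f g : X -> Y) :=
  homotopic_rel R set0 f g.

Definition path_space (R : realType) (X : topologicalType) : Type :=
  continuousType (I01 R) X.

HB.instance Definition _ (R : realType) (X : topologicalType) :=
  gen_eqMixin (path_space R X).
HB.instance Definition _ (R : realType) (X : topologicalType) :=
  gen_choiceMixin (path_space R X).
HB.instance Definition _ (R : realType) (X : topologicalType) :=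
  Topological.copy (path_space R X)
    (@initial_topology (path_space R X) {compact-open, I01 R -> X}
       (fun gamma => gamma : I01 R -> X)).

Definition path_ends (R : realType) (X : topologicalType)
    (gamma : path_space R X) : X * X :=
  (gamma (clip 0), gamma (clip 1)).

Definition secat_le (R : realType) {E Z : topologicalType} (p : E -> Z)
    (k : nat) : Prop :=
  exists U : 'I_k.+1 -> set Z,
    [/\ forall i, open (U i),
        \bigcup_i U i = [set: Z] &
        forall i, exists2 s : set_type (U i) -> E,
          continuous s & homotopic R (p \o s) (set_val : set_type (U i) -> Z)].

Definition secat {R : realType} {E Z : topologicalType} (p : E -> Z) : \bar R :=
  least [set k | secat_le R p k].

Definition TC (R : realType) (X : topologicalType) : \bar R :=
  secat (@path_ends R X).

Definition cube (R : realType) (n : nat) : set 'rV[R]_n :=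
  [set t | forall i, 0 <= t 0 i <= 1].
Arguments cube R n : clear implicits.

Definition cube_boundary (R : realType) (n : nat) : set (set_type (cube R n)) :=
  set_val @^-1` [set t : 'rV[R]_n | exists i, t 0 i = 0 \/ t 0 i = 1].

Definition pi_trivial (R : realType) (X : topologicalType) (n : nat) (x : X) :=
  forall f : set_type (cube R n) -> X,
    continuous f -> (forall t, cube_boundary t -> f t = x) ->
    homotopic_rel R (@cube_boundary R n) f (cst x).

Definition loop (R : realType) (X : topologicalType) (x : X) :
    set (I01 R -> X) :=
  [set p | [/\ continuous p, p (clip 0) = x & p (clip 1) = x]].

Definition concat (R : realType) (X : topologicalType) (p q : I01 R -> X) :
    I01 R -> X :=
  fun t => if set_val t <= 2^-1 then p (clip (2 * set_val t))
           else q (clip (2 * set_val t - 1)).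

(* pi_1(X, x) is isomorphic to G: [phi] induces the isomorphism from homotopy
   classes of loops; its values off [loop x] are irrelevant. *)
Definition pi1_iso (R : realType) (X : topologicalType) (x : X)
    (G : groupType) : Prop :=
  exists phi : (I01 R -> X) -> G,
    [/\ forall p q, loop x p -> loop x q ->
          phi p = phi q <-> homotopic_rel R [set clip 0; clip 1] p q,
        forall p q, loop x p -> loop x q -> phi (concat p q) = (phi p * phi q)%g &
        forall g, exists2 p, loop x p & phi p = g].

Definition sqnorm (R : realType) (n : nat) (t : 'rV[R]_n) : R :=
  \sum_(i < n) t 0 i ^+ 2.

Definition disk (R : realType) (n : nat) : set 'rV[R]_n :=
  [set t | sqnorm t <= 1].
Arguments disk R n : clear implicits.

Definition disk_interior (R : realType) (n : nat) : set (set_type (disk R n)) :=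
  set_val @^-1` [set t : 'rV[R]_n | sqnorm t < 1].

Definition disk_boundary (R : realType) (n : nat) : set (set_type (disk R n)) :=
  set_val @^-1` [set t : 'rV[R]_n | sqnorm t = 1].

Section CW.
Variables (R : realType) (X : topologicalType) (cell : Type).
Variables (dim : cell -> nat) (Phi : forall e, set_type (disk R (dim e)) -> X).
Arguments Phi e _ : clear implicits.

Definition open_cell (e : cell) : set X :=
  Phi e @` @disk_interior R (dim e).

(* J.H.C. Whitehead's definition, by characteristic maps (see Hatcher,
   Algebraic Topology, Proposition A.2). [cw_inj] and [cw_open] say that a
   characteristic map restricts to a homeomorphism from the open disk to the
   open cell. *)
Record cw_structure : Prop := CWStructure {
  cw_hausdorff : hausdorff_space X;
  cw_continuous : forall e, continuous (Phi e);
  cw_inj : forall e s t, disk_interior s -> disk_interior t ->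
    Phi e s = Phi e t -> s = t;
  cw_open : forall e O, open O -> O `<=` @disk_interior R (dim e) ->
    exists2 V, open V & Phi e @` O = V `&` open_cell e;
  cw_cover : forall x, exists e, open_cell e x;
  cw_disjoint : forall e e' x, open_cell e x -> open_cell e' x -> e = e';
  cw_closure_finite : forall e, exists F : set cell,
    [/\ finite_set F,
        forall e', F e' -> (dim e' < dim e)%N &
        Phi e @` @disk_boundary R (dim e) `<=` \bigcup_(e' in F) open_cell e'];
  cw_weak : forall C : set X, closed C <-> forall e, closed (Phi e @^-1` C)
}.

End CW.

Definition cw_complex (R : realType) (X : topologicalType) : Prop :=
  exists (cell : Type) (dim : cell -> nat)
         (Phi : forall e, set_type (disk R (dim e)) -> X),
    cw_structure Phi.

Definition eilenberg_maclane (R : realType) (G : groupType)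
    (X : topologicalType) : Prop :=
  [/\ cw_complex R X,
      connected [set: X],
      exists x : X, pi1_iso R x G &
      forall (x : X) n, (2 <= n)%N -> pi_trivial R n x].

(* G = A x| B, with A and B identified with subgroups of G by [iA] and [iB] *)
Definition semidirect (A B G : groupType)
    (iA : {multiplicative A -> G}) (iB : {multiplicative B -> G}) : Prop :=
  [/\ injective iA, injective iB,
      forall a g, range iA (iA a ^ g)%g,
      range iA `&` range iB = [set 1%g] &
      forall g, exists a b, g = (iA a * iB b)%g].

(* Main.v *)
Require Import Defs.
From HB Require Import structures.
From mathcomp Require Import all_boot all_order all_algebra.
From mathcomp Require Import all_classical all_reals all_analysis.
From mathcomp Require Import zify ring lra.
Import numFieldNormedType.Exports.

(** The inequality is the lower bound of Grant, Lupton and Oprea for two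
    subgroups A and B of G whose conjugates meet only in the identity. Write P
    for A x B. The inclusions of A and B in G give a map from the classifying
    space BP to X x X. Suppose that X x X is covered by open sets U_0, ...,
    U_k, each with a continuous choice of a path from y.1 to y.2 for y in U_i.
    At a point of EP that lies over U_i, run from the base point of X along
    the first coordinate, cross over by the chosen path, and return along the
    second coordinate. The class of this loop, read at the right sheet, is an
    element of G that does not change along a path in the part over U_i, and P
    acts on these elements by (a, b).x = a x b^-1. As G is a semidirect
    product, every x is a b^-1 for exactly one pair, so this action is simply
    transitive: the part of EP over U_i carries a locally constant P-map to P.
    The k + 1 parts cover EP, hence the identity of EP factors, up to
    equivariant homotopy, through the join of k + 1 copies of P. That join has
    dimension k, so H^n(P; M) = 0 for n > k.

    The factorization is carried out on cochains, that is, on functions of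
    tuples. A chain map is represented by the operator that it induces on
    cochains with all coefficient groups, natural in the coefficients. Two
    recursive constructions suffice: [subdiv], which cones off the subdivided
    boundary at a prescribed apex, and [homot], the homotopy that coning off
    produces; [subdiv_delta] and [homotP] are their chain rules. Barycentric
    subdivision makes the tuples of points of a simplex small
    ([flags_contract]), so that each lies in one U_i with a constant label.
    Coning off a small tuple and its faces, each at the pair (least such i,
    label), yields sequences along which i decreases, and strictly so unless
    the pair is repeated; [strict_part] keeps the strictly decreasing ones,
    and these have length at most k + 1. The necessary number of subdivisions
    depends on the simplex, without a bound, because P may be infinite. The
    operators for different numbers are therefore interpolated by a telescope
    of prism homotopies ([reduction]). By [homotP] the result is homotopic to
    the identity, and it vanishes on tuples of length k + 2 or more.

    The map from BP to X x X consists of singular simplices of X indexed by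
    the tuples of G ([bar_simplex]). They are chosen dimension by dimension:
    edges are loops in prescribed classes, triangles exist as the loops
    multiply correctly in the fundamental group ([extend_triangle]), and every
    higher boundary can be filled since the higher homotopy groups vanish
    ([extend_simplex]). The labels and their properties are [label_mul],
    [label_face] and [label_small]. *)

Set Implicit Arguments.
Unset Strict Implicit.
Unset Printing Implicit Defensive.

Import Order.TTheory GRing.Theory Num.Theory.
Local Open Scope classical_set_scope.
Local Open Scope ring_scope.

(** * Cochains on tuples and natural operators on them *)

Definition del {T : Type} (i : nat) (v : seq T) : seq T :=
  take i v ++ drop i.+1 v.

Section Del.
Variables (T T' : Type).
Implicit Types (v : seq T) (i : nat).

Lemma del0 x v : del 0 (x :: v) = v.
Proof. by rewrite /del take0 /= drop0. Qed.

Lemma delS i x v : del i.+1 (x :: v) = x :: del i v.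
Proof. by []. Qed.

Lemma size_del i v : (i < size v)%N -> size (del i v) = (size v).-1.
Proof.
move=> iv; rewrite /del size_cat size_take iv size_drop; lia.
Qed.

Lemma map_del (f : T -> T') i v : map f (del i v) = del i (map f v).
Proof. by rewrite /del map_cat map_take map_drop. Qed.

Lemma nth_del x0 i j v : nth x0 (del i v) j = nth x0 v (bump i j).
Proof.
elim: v i j => [|x v IH] i j; first by rewrite /del take_oversize// !nth_nil.
case: i => [|i]; first by rewrite del0 /bump add1n.
by case: j => [|j]; rewrite delS //= IH /bump ltnS addnS.
Qed.

End Del.

Lemma mem_del (T : eqType) i (v : seq T) x : x \in del i v -> x \in v.
Proof.
rewrite /del mem_cat => /orP[/mem_take//|/mem_drop//].
Qed.

Section Coboundary.
Variable T : Type.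

(** The empty tuple is allowed, and so [delta F [:: x]] is [F [::]]: this is
    the augmented complex, in which every coning-off recursion can start. *)
Definition delta (M : zmodType) (F : seq T -> M) (v : seq T) : M :=
  \sum_(i < size v) F (del i v) *~ ((-1) ^+ i).

Definition at_head {M : Type} (F : seq T -> M) (x : T) : seq T -> M :=
  fun s => F (x :: s).

Lemma delta_nil (M : zmodType) (F : seq T -> M) : delta F [::] = 0.
Proof. by rewrite /delta big_ord0. Qed.

(** The cone formula d(x v) = v - x (d v), dualized; nearly every induction
    below reduces to it. *)
Lemma delta_cons (M : zmodType) (F : seq T -> M) x v :
  delta F (x :: v) = F v - delta (at_head F x) v.
Proof.
rewrite /delta big_ord_recl del0 expr0 mulr1z; congr (_ + _).
rewrite -sumrN; apply: eq_bigr => i _.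
by rewrite /at_head lift0 delS exprS mulN1r mulrNz.
Qed.

Lemma at_head_delta (M : zmodType) (F : seq T -> M) x :
  at_head (delta F) x = fun v => F v - delta (at_head F x) v.
Proof. by apply: funext => v; rewrite /at_head delta_cons. Qed.

Lemma eq_delta (M : zmodType) (F F' : seq T -> M) v :
  (forall i, (i < size v)%N -> F (del i v) = F' (del i v)) ->
  delta F v = delta F' v.
Proof. by move=> FF'; apply: eq_bigr => i _; rewrite FF'. Qed.

Lemma delta0 (M : zmodType) (F : seq T -> M) v :
  (forall i, (i < size v)%N -> F (del i v) = 0) -> delta F v = 0.
Proof. by move=> F0; rewrite /delta big1// => i _; rewrite F0// mul0rz. Qed.

Lemma delta_sub (M : zmodType) (F F' : seq T -> M) v :
  delta (fun s => F s - F' s) v = delta F v - delta F' v.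
Proof.
by rewrite /delta -sumrB; apply: eq_bigr => i _; rewrite mulrzBl.
Qed.

Lemma delta_add (M : zmodType) (F F' : seq T -> M) v :
  delta (fun s => F s + F' s) v = delta F v + delta F' v.
Proof.
by rewrite /delta -big_split; apply: eq_bigr => i _; rewrite mulrzDl.
Qed.

Lemma delta_delta (M : zmodType) (F : seq T -> M) v : delta (delta F) v = 0.
Proof.
elim: v F => [|x v IH] F; first exact: delta_nil.
by rewrite delta_cons at_head_delta delta_sub IH subr0 subrr.
Qed.

End Coboundary.

Lemma delta_map (T T' : Type) (M : zmodType) (f : T -> T') (F : seq T' -> M) v :
  delta (fun s => F (map f s)) v = delta F (map f v).
Proof.
by rewrite /delta size_map; apply: eq_bigr => i _; rewrite map_del.
Qed.

(** An operator that is natural in the coefficients is evaluation on integral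
    chains: [op F y] is the value of [F] on a chain attached to [y].
    Naturality under additive maps is easier to check than an explicit chain
    would be to carry around, and it gives both additivity and equivariance. *)
Definition natural {X Y : Type} (op : forall M : zmodType, (X -> M) -> Y -> M) :=
  forall (M M' : zmodType) (a : {additive M -> M'}) (F : X -> M) y,
    op M' (fun x => a (F x)) y = a (op M F y).

Section Natural.
Variables (X Y : Type) (op : forall M : zmodType, (X -> M) -> Y -> M).
Hypothesis op_nat : natural op.

(** Additivity follows from naturality: apply [op] to the pair (F, G) with
    values in M x M and push forward along the projections and along the
    difference. *)
Lemma natural_sub (M : zmodType) (F G : X -> M) y :
  op (fun x => F x - G x) y = op F y - op G y.
Proof.
have sub_additive : zmod_morphism (fun p : M * M => p.1 - p.2).
  by move=> [x1 x2] [y1 y2] /=; rewrite !opprB [y2 - x2]addrC addrACA [y2 - y1]addrC.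
pose sub : {additive (M * M)%type -> M} :=
  HB.pack (fun p : M * M => p.1 - p.2)
    (GRing.isZmodMorphism.Build _ _ _ sub_additive).
have := op_nat sub (fun x => (F x, G x)) y; rewrite /= => ->.
have /= <- := op_nat (fst : {additive (M * M)%type -> M}) (fun x => (F x, G x)) y.
by have /= <- := op_nat (snd : {additive (M * M)%type -> M}) (fun x => (F x, G x)) y.
Qed.

Lemma natural0 (M : zmodType) y : op (fun=> 0 : M) y = 0.
Proof.
rewrite -[RHS](subrr (op (fun=> 0 : M) y)) -natural_sub.
by congr (op _ y); apply/funext => x; rewrite subrr.
Qed.

End Natural.

Lemma natural_delta T : natural (@delta T).
Proof.
move=> M M' a F v; rewrite /delta raddf_sum; apply: eq_bigr => i _.
by rewrite raddfMz.
Qed.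

Section Subdivision.
Variables (T T' : Type) (b : seq T -> T').

(** The dual of the chain map that sends a tuple [v] to the cone, with apex [b
    v], over the image of its boundary. With [b] the barycenter it is
    barycentric subdivision. The first argument of the recursion is the length
    of the tuple. *)
Fixpoint subdiv_rec (M : zmodType) n (F : seq T' -> M) (v : seq T) : M :=
  if n is n'.+1 then delta (subdiv_rec n' (at_head F (b v))) v else F [::].

Definition subdiv (M : zmodType) (F : seq T' -> M) (v : seq T) : M :=
  subdiv_rec (size v) F v.

Lemma subdiv_nil (M : zmodType) (F : seq T' -> M) : subdiv F [::] = F [::].
Proof. by []. Qed.

Lemma subdivE (M : zmodType) (F : seq T' -> M) v : (0 < size v)%N ->
  subdiv F v = delta (subdiv (at_head F (b v))) v.
Proof.
rewrite /subdiv; case vn: (size v) => [|n] //= _.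
by apply: eq_delta => i iv; rewrite size_del// vn.
Qed.

Lemma natural_subdiv : natural (@subdiv).
Proof.
move=> M M' a F v; rewrite /subdiv; move: (size v) => n; elim: n F v => //= n IH F v.
rewrite -natural_delta; apply: eq_delta => i _; exact: IH.
Qed.

(** Coning off is a chain map whatever the apex is, as the boundary of a cone
    is its base up to the cone over the boundary of the base. *)
Lemma subdiv_delta (M : zmodType) (F : seq T' -> M) v :
  subdiv (delta F) v = delta (subdiv F) v.
Proof.
have [n] := ubnP (size v); elim: n F v => // n IH F v; rewrite ltnS => vn.
case: (posnP (size v)) => [/size0nil -> |v0]; first by rewrite subdiv_nil !delta_nil.
rewrite subdivE// at_head_delta.
transitivity (delta (fun s => subdiv F s -
    delta (subdiv (at_head F (b v))) s) v); last first.
  by rewrite delta_sub delta_delta subr0.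
apply: eq_delta => i iv; rewrite (natural_sub natural_subdiv) IH//.
by rewrite size_del//; lia.
Qed.

(** The tuples on which [subdiv F v] evaluates [F]: the apexes of a decreasing
    sequence of faces of [v]. *)
Inductive flag : seq T -> seq T' -> Prop :=
| flag_nil : flag [::] [::]
| flag_cons v i s : (i < size v)%N -> flag (del i v) s -> flag v (b v :: s).

Lemma size_flag v s : flag v s -> size s = size v.
Proof. by elim => // {}v i {}s iv _ /= ->; rewrite size_del//; lia. Qed.

Lemma eq_subdiv (M : zmodType) (F F' : seq T' -> M) v :
  (forall s, flag v s -> F s = F' s) -> subdiv F v = subdiv F' v.
Proof.
have [n] := ubnP (size v); elim: n F F' v => // n IH F F' v; rewrite ltnS => vn.
case: (posnP (size v)) => [/size0nil -> |v0] FF'.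
  by rewrite !subdiv_nil FF'//; exact: flag_nil.
rewrite !subdivE//; apply: eq_delta => i iv; apply: IH.
  by rewrite size_del//; lia.
by move=> s vs; apply: FF'; apply: flag_cons vs.
Qed.

End Subdivision.

Section Homotopy.
Variables (T : Type) (b : seq T -> T).
Variable psi : forall M : zmodType, (seq T -> M) -> seq T -> M.

(** The dual of the homotopy from the identity to [psi] that sends [v] to the
    cone, with apex [b v], over v - psi v - h (d v); the expression in the
    cone is a cycle, by induction. *)
Fixpoint homot_rec (M : zmodType) n (F : seq T -> M) (v : seq T) : M :=
  if n is n'.+1 then F (b v :: v) - psi (at_head F (b v)) v
                     - delta (homot_rec n' (at_head F (b v))) v
  else 0.

Definition homot (M : zmodType) (F : seq T -> M) (v : seq T) : M :=
  homot_rec (size v) F v.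

Lemma homot_nil (M : zmodType) (F : seq T -> M) : homot F [::] = 0.
Proof. by []. Qed.

Lemma homotE (M : zmodType) (F : seq T -> M) v : (0 < size v)%N ->
  homot F v = F (b v :: v) - psi (at_head F (b v)) v
              - delta (homot (at_head F (b v))) v.
Proof.
rewrite /homot; case vn: (size v) => [|n] //= _.
by congr (_ - _); apply: eq_delta => i iv; rewrite size_del// vn.
Qed.

Hypothesis psi_nat : natural psi.

Lemma natural_homot : natural (@homot).
Proof.
move=> M M' a F v; rewrite /homot; move: (size v) => n; elim: n F v => [|n IH] F v /=.
  by rewrite raddf0.
rewrite !raddfB -psi_nat; congr (_ - _).
by rewrite -natural_delta; apply: eq_delta => i _; exact: IH.
Qed.

Hypothesis psi_nil : forall (M : zmodType) (F : seq T -> M), psi F [::] = F [::].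
Hypothesis psi_delta : forall (M : zmodType) (F : seq T -> M) v,
  psi (delta F) v = delta (psi F) v.

Lemma homotP (M : zmodType) (F : seq T -> M) v :
  homot (delta F) v + delta (homot F) v = F v - psi F v.
Proof.
have [n] := ubnP (size v); elim: n F v => // n IH F v; rewrite ltnS => vn.
case: (posnP (size v)) => [/size0nil -> |v0].
  by rewrite homot_nil delta_nil psi_nil addr0 subrr.
rewrite homotE// at_head_delta delta_cons (natural_sub psi_nat) psi_delta.
have -> : delta (homot (fun s => F s - delta (at_head F (b v)) s)) v =
   delta (homot F) v - (delta (at_head F (b v)) v - delta (psi (at_head F (b v))) v).
  rewrite -(addr0 (delta (psi _) v)).
  rewrite -(delta_delta (homot (at_head F (b v))) v) -delta_add -!delta_sub.
  apply: eq_delta => i iv; rewrite (natural_sub natural_homot); congr (_ - _).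
  apply/eqP; rewrite opprD addrA eq_sym subr_eq; apply/eqP; symmetry.
  by apply: IH; rewrite size_del//; lia.
by rewrite [- (delta (homot F) v - _)]opprB addrA subrK opprB addrAC !addrA !subrK.
Qed.

End Homotopy.

Section Locality.
Variables (T T' : Type).

(** Coning off commutes with maps that preserve the apexes; affine maps
    preserve barycenters. *)
Lemma subdiv_map (U U' : Type) (b : seq T -> T') (c : seq U -> U')
    (f : U -> T) (f' : U' -> T') (M : zmodType) (F : seq T' -> M) v :
  (forall s, (0 < size s)%N -> b (map f s) = f' (c s)) ->
  subdiv c (fun s => F (map f' s)) v = subdiv b F (map f v).
Proof.
move=> bc; have [n] := ubnP (size v); elim: n F v => // n IH F v.
rewrite ltnS => vn; case: (posnP (size v)) => [/size0nil ->//|v0].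
rewrite [RHS]subdivE ?size_map// -delta_map subdivE// bc//.
apply: eq_delta => i iv; rewrite -IH//; by rewrite size_del//; lia.
Qed.

End Locality.

Section StrictTuples.
Variables (P : Type) (M : zmodType).

(** Vertices of the join of several copies of [P]: the index of a copy and an
    element of it. In the sequences that occur the index decreases weakly, and
    equal indices carry equal elements. *)
Definition ltidx (x y : nat * P) : bool := (y.1 < x.1)%N.
Definition leidx (x y : nat * P) : Prop := (y.1 < x.1)%N \/ y = x.

Fixpoint chained (x : nat * P) (s : seq (nat * P)) : Prop :=
  if s is y :: s' then leidx x y /\ chained y s' else True.

(** The projection from weakly to strictly decreasing sequences, which
    discards the degenerate ones. *)
Definition strict_part (F : seq P -> M) (s : seq (nat * P)) : M :=
  if sorted ltidx s then F (map snd s) else 0.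

Lemma chained_below x y s : ltidx x y -> chained y s ->
  all (ltidx x) s.
Proof.
elim: s y => //= z s IH y xy [yz zs].
have xz : ltidx x z by case: yz => [yz|->//]; rewrite /ltidx in xy *; lia.
by rewrite xz (IH z).
Qed.

(** If exactly one vertex is repeated, then the two faces that omit one of its
    copies are equal and have opposite signs, and all other faces are
    degenerate. *)
Lemma strict_part_delta (F : seq P -> M) x s : chained x s ->
  delta (strict_part F) (x :: s) = strict_part (delta F) (x :: s).
Proof.
elim: s x F => [|y s IH] x F.
  by rewrite delta_cons delta_nil /strict_part /= delta_cons delta_nil.
move=> /= [xy ys]; case: (xy) => [yx|->].
  have lxy : ltidx x y := yx.
  have below : all (ltidx x) (y :: s) by rewrite /= lxy (chained_below yx).
  rewrite delta_cons.
  have -> : delta (at_head (strict_part F) x) (y :: s) =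
            delta (strict_part (at_head F x.2)) (y :: s).
    apply: eq_delta => i _; rewrite /at_head /strict_part /=.
    have : all (ltidx x) (del i (y :: s)).
      rewrite /del all_cat; move: below; rewrite -{1}(cat_take_drop i (y :: s)).
      rewrite all_cat => /andP[-> /=].
      rewrite -(cat_take_drop 1 (drop i (y :: s))) all_cat drop_drop.
      by rewrite add1n => /andP[].
    by case: (del i _) => //= z r /andP[-> _].
  rewrite IH// /strict_part /= lxy /=.
  by case: ifP => _; [rewrite [in RHS]delta_cons|rewrite subr0].
rewrite [RHS]/strict_part /= {1}/ltidx ltnn /=.
rewrite delta_cons delta_cons opprB addrCA /at_head.
rewrite subrr addr0 delta0// => i _.
by rewrite /strict_part /= {1}/ltidx ltnn.
Qed.

End StrictTuples.

Lemma natural_strict_part P : natural (fun M => @strict_part P M).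
Proof.
by move=> M M' a F s; rewrite /strict_part; case: ifP; rewrite ?raddf0.
Qed.

(** * Points of simplices and barycentric subdivision *)

(** All simplices live in the space of real sequences, with the topology of
    pointwise convergence, so that faces need no change of type. *)
Definition pt (R : realType) : Type := nat -> R.

HB.instance Definition _ (R : realType) :=
  Topological.copy (pt R) {ptws nat -> R}.

Section Points.
Variable R : realType.
Local Notation pt := (pt R).

(** Barycentric coordinates on the simplex with [n] vertices, of dimension [n
    - 1]; the coordinates from the [n]-th on vanish. *)
Definition in_simplex (n : nat) (t : pt) : Prop :=
  [/\ forall i, 0 <= t i, forall i, (n <= i)%N -> t i = 0 &
      \sum_(i < n) t i = 1].

Definition vtx (j : nat) : pt := fun i => (i == j)%:R.

(** The inclusion of the face opposite to the [j]-th vertex. *)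
Definition insert0 (j : nat) (t : pt) : pt :=
  fun i => if (i < j)%N then t i else if i == j then 0 else t i.-1.

Definition vertices (n : nat) : seq pt := map vtx (iota 0 n).

Definition bary (v : seq pt) : pt :=
  fun i => (\sum_(t <- v) t i) / (size v)%:R.

Definition near_pt (e : R) (t t' : pt) : Prop := forall i, `|t i - t' i| <= e.

(** A weak form of convexity, which suffices for all points that arise by
    repeated barycentric subdivision. *)
Definition bary_closed (C : pt -> Prop) : Prop :=
  forall v, (0 < size v)%N -> (forall t, t \in v -> C t) -> C (bary v).

Lemma size_vertices n : size (vertices n) = n.
Proof. by rewrite size_map size_iota. Qed.

Lemma insert0_vtx i j : insert0 i (vtx j) = vtx (bump i j).
Proof.
apply/funext => l; rewrite /insert0 /vtx /bump.
by case: ltngtP => ?; case: leqP => ?; do ?[case: eqP => ?]; rewrite //=;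
  exfalso; lia.
Qed.

Lemma del_vertices i n : (i < n.+1)%N ->
  del i (vertices n.+1) = map (insert0 i) (vertices n).
Proof.
move=> i_n; apply: (@eq_from_nth _ (vtx 0)).
  by rewrite size_del !size_map !size_iota.
move=> j; rewrite size_del size_vertices//= => jn.
have bn : (bump i j < n.+1)%N by rewrite /bump; case: leqP; lia.
by rewrite nth_del (nth_map 0%N) ?size_iota// nth_iota//
  (nth_map (vtx 0)) ?size_vertices// (nth_map 0%N) ?size_iota// nth_iota// insert0_vtx.
Qed.

Lemma insert0_bary i v : (0 < size v)%N -> bary (map (insert0 i) v) = insert0 i (bary v).
Proof.
move=> v0; apply/funext => l; rewrite /bary /insert0 size_map big_map.
by case: ifP => // _; case: ifP => // _; rewrite big1_seq ?mul0r.
Qed.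

Lemma bary_closed_and C C' : bary_closed C -> bary_closed C' ->
  bary_closed (fun t => C t /\ C' t).
Proof.
by move=> bC bC' v v0 vC; split; [apply: bC|apply: bC'] => // t /vC [].
Qed.

Lemma bary_near_weak (v : seq pt) (t : pt) : (0 < size v)%N ->
  forall i, `|t i - bary v i| <= (\sum_(s <- v) `|t i - s i|) / (size v)%:R.
Proof.
move=> v0 i; have n0 : 0 < (size v)%:R :> R by rewrite ltr0n.
rewrite ler_pdivlMr// -{1}(gtr0_norm n0) -normrM mulrBl /bary divfK ?gt_eqF//.
have -> : t i * (size v)%:R = \sum_(s <- v) t i.
  by rewrite big_const_seq count_predT iter_addr_0 mulr_natr.
by rewrite -sumrB ler_norm_sum.
Qed.

Lemma near_bary_closed e t : bary_closed (near_pt e t).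
Proof.
move=> v v0 vC i; apply: (le_trans (bary_near_weak t v0 i)).
rewrite ler_pdivrMr ?ltr0n// mulr_natr.
rewrite -iter_addr_0 -(count_predT v) -big_const_seq big_seq [leRHS]big_seq.
by apply: ler_sum => s sv; exact: vC.
Qed.

Lemma in_simplex_bary_closed n : bary_closed (in_simplex n).
Proof.
move=> v v0 vC; have n0 : 0 < (size v)%:R :> R by rewrite ltr0n.
split => [i|i ni|].
- apply: divr_ge0; last exact: ltW.
  by rewrite big_seq; apply: sumr_ge0 => s /vC [].
- by rewrite /bary big1_seq ?mul0r// => s /= /vC [_ ->].
- rewrite /bary -mulr_suml exchange_big /=.
  rewrite (eq_big_seq (fun=> 1)) => [|s /vC [_ _ ->]//].
  by rewrite big_const_seq count_predT iter_addr_0 divff// gt_eqF.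
Qed.

Lemma in_simplex_vtx n j : (j < n)%N -> in_simplex n (vtx j).
Proof.
move=> jn; split=> [i|i ni|]; rewrite /vtx.
- by rewrite ler0n.
- by case: eqP => //; lia.
- by rewrite (bigD1 (Ordinal jn))//= eqxx big1 ?addr0// => i /negbTE;
    rewrite -val_eqE /= => ->.
Qed.

Lemma in_simplex_vertices n t : t \in vertices n -> in_simplex n t.
Proof.
by move=> /mapP[j]; rewrite mem_iota add0n => /andP[_ jn] ->; exact: in_simplex_vtx.
Qed.

Lemma in_simplex_le1 n t i : in_simplex n t -> t i <= 1.
Proof.
move=> [t0 tn t1]; case: (ltnP i n) => ni; last by rewrite tn.
by rewrite -t1 (bigD1 (Ordinal ni))//= lerDl sumr_ge0.
Qed.

Lemma in_simplex_near n t t' : in_simplex n t -> in_simplex n t' -> near_pt 1 t t'.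
Proof.
move=> st st' i; have [[t0 _ _] [t0' _ _]] := (st, st').
have := in_simplex_le1 i st; have := in_simplex_le1 i st'; have := t0 i; have := t0' i.
by rewrite ler_norml; lra.
Qed.

(** One of the summands of [bary v - s] vanishes, as [s] is an entry of [v];
    this gains the factor 1 - 1/n. *)
Lemma bary_contract K v e s : 0 <= e -> (size v <= K)%N ->
  {in v &, forall x y, near_pt e x y} -> s \in v ->
  near_pt ((1 - K%:R^-1) * e) (bary v) s.
Proof.
move=> e0 vK ve sv i; have v0 : (0 < size v)%N by case: v sv {vK ve}.
have n0 : 0 < (size v)%:R :> R by rewrite ltr0n.
rewrite distrC; apply: (le_trans (bary_near_weak s v0 i)).
rewrite ler_pdivrMr// (big_rem s sv) /= subrr normr0 add0r.
apply: (@le_trans _ _ (e *+ (size v).-1)).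
  rewrite -(size_rem sv) -iter_addr_0 -(count_predT (rem s v)) -big_const_seq.
  rewrite big_seq [leRHS]big_seq.
  by apply: ler_sum => x xv; apply: ve => //; exact: (mem_rem xv).
rewrite -[leLHS]mulr_natr [leRHS]mulrAC [leRHS]mulrC ler_wpM2l//.
rewrite -subn1 natrB// mulrBl mul1r lerB// mulrC ler_pdivrMr ?mul1r ?ler_nat//.
by rewrite ltr0n (leq_trans v0).
Qed.

Lemma flag_in C v s : bary_closed C -> flag bary v s ->
  (forall t, t \in v -> C t) -> forall t, t \in s -> C t.
Proof.
move=> bC; elim => // {}v i {}s iv _ IH vC t; rewrite inE => /orP[/eqP ->|].
  by apply: bC => //; exact: leq_ltn_trans iv.
by apply: IH => x /mem_del; exact: vC.
Qed.

(** The factor is that of the largest dimension, so that it can be kept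
    through the induction on faces. *)
Lemma flag_contract K v s e : 0 <= e -> (size v <= K)%N ->
  {in v &, forall x y, near_pt e x y} -> flag bary v s ->
  {in s &, forall x y, near_pt ((1 - K%:R^-1) * e) x y}.
Proof.
move=> e0 vK ve vs; elim: vs vK ve => // {}v i {}s iv vs IH vK ve.
have {}IH : {in s &, forall x y, near_pt ((1 - K%:R^-1) * e) x y}.
  apply: IH; first by rewrite size_del//; lia.
  by move=> x y /mem_del xv /mem_del yv; exact: ve.
have bs x : x \in s -> near_pt ((1 - K%:R^-1) * e) (bary v) x.
  move=> xs; apply: (flag_in _ vs) xs; first exact: near_bary_closed.
  by move=> t /mem_del tv; apply: bary_contract.
have ce : 0 <= (1 - K%:R^-1) * e.
  have K0 : (0 < K)%N by exact: leq_trans (leq_ltn_trans (leq0n i) iv) vK.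
  by rewrite mulr_ge0// subr_ge0 invf_le1 ?ler1n ?ltr0n.
move=> x y; rewrite !inE => /orP[/eqP->|xs] /orP[/eqP->|ys].
- by move=> j; rewrite subrr normr0.
- exact: bs.
- by move=> j; rewrite distrC; apply: bs.
- exact: IH.
Qed.

Inductive flags : nat -> seq pt -> seq pt -> Prop :=
| flags0 v : flags 0 v v
| flagsS n v s s' : flags n v s -> flag bary s s' -> flags n.+1 v s'.

Lemma size_flags n v s : flags n v s -> size s = size v.
Proof. by elim => // {}n {}v s1 s2 _ <- /size_flag. Qed.

Lemma flags_in C n v s : bary_closed C -> flags n v s ->
  (forall t, t \in v -> C t) -> forall t, t \in s -> C t.
Proof.
move=> bC; elim => // {}n {}v s1 s2 _ IH s12 vC; apply: (flag_in bC s12).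
exact: IH.
Qed.

Lemma flags_contract n v s e : 0 <= e ->
  {in v &, forall x y, near_pt e x y} -> flags n v s ->
  {in s &, forall x y, near_pt ((1 - (size v)%:R^-1) ^+ n * e) x y}.
Proof.
move=> e0 ve vs; elim: vs ve => [{}v|{}n {}v s1 s2 vs1 IH s12] ve.
  by rewrite expr0 mul1r.
case: (posnP (size v)) => [v0|v0].
  by move: (size_flag s12); rewrite (size_flags vs1) v0 => /size0nil ->.
rewrite exprS -mulrA; apply: flag_contract s12; last exact: IH.
  by rewrite mulr_ge0// exprn_ge0// subr_ge0 invf_le1 ?ler1n ?ltr0n.
by rewrite (size_flags vs1).
Qed.

Definition sd (M : zmodType) : (seq pt -> M) -> seq pt -> M := subdiv bary (M := M).

Definition sd_iter (M : zmodType) n : (seq pt -> M) -> seq pt -> M :=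
  iter n (@sd M).

Lemma natural_sd_iter n : natural (fun M => @sd_iter M n).
Proof.
elim: n => [|n IH] M M' a F v //=; rewrite /sd -natural_subdiv.
by congr (subdiv _ _ v); apply/funext => s; exact: IH.
Qed.

Lemma sd_iter_delta (M : zmodType) n (F : seq pt -> M) v :
  sd_iter n (delta F) v = delta (sd_iter n F) v.
Proof.
elim: n v => [|n IH] v //=; rewrite -subdiv_delta.
by congr (subdiv _ _ v); apply/funext => s; exact: IH.
Qed.

Lemma eq_sd_iter (M : zmodType) n (F F' : seq pt -> M) v :
  (forall s, flags n v s -> F s = F' s) -> sd_iter n F v = sd_iter n F' v.
Proof.
elim: n F F' => [|n IH] F F' FF'; first by apply: FF'; exact: flags0.
rewrite /sd_iter !iterSr; apply: IH => s vs; apply: eq_subdiv => s' ss'.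
by apply: FF'; apply: flagsS ss'.
Qed.

Lemma sd_map (M : zmodType) i (F : seq pt -> M) v :
  sd (fun s => F (map (insert0 i) s)) v = sd F (map (insert0 i) v).
Proof. by apply: subdiv_map => s s0; exact: insert0_bary. Qed.

Lemma sd_iter_map (M : zmodType) n i (F : seq pt -> M) v :
  sd_iter n (fun s => F (map (insert0 i) s)) v = sd_iter n F (map (insert0 i) v).
Proof.
rewrite /sd_iter; elim: n F => // n IH F; rewrite !iterSr -IH.
by congr (iter n _ _ v); apply/funext => s; exact: sd_map.
Qed.

(** The homotopy from the identity to barycentric subdivision. *)
Definition prism (M : zmodType) : (seq pt -> M) -> seq pt -> M :=
  homot bary sd (M := M).

Lemma natural_prism : natural prism.
Proof. exact/natural_homot/natural_subdiv. Qed.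

Lemma prismP (M : zmodType) (F : seq pt -> M) v :
  prism (delta F) v + delta (prism F) v = F v - sd F v.
Proof.
apply: homotP; [exact: natural_subdiv|by []|].
by move=> M' F' v'; exact: subdiv_delta.
Qed.

(** The prism over a tuple stays in every set that contains the tuple and is
    closed under barycenters; hence it does not leave a set on which a label
    is constant. *)
Lemma eq_prism C (M : zmodType) (F F' : seq pt -> M) v : bary_closed C ->
  (forall t, t \in v -> C t) ->
  (forall s, size s = (size v).+1 -> (forall t, t \in s -> C t) -> F s = F' s) ->
  prism F v = prism F' v.
Proof.
move=> bC; have [n] := ubnP (size v); elim: n F F' v => // n IH F F' v.
rewrite ltnS => vn vC FF'; case: (posnP (size v)) => [/size0nil ->//|v0].
have Cb : C (bary v) by apply: bC.
have FF'b s : size s = size v -> (forall t, t \in s -> C t) ->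
    at_head F (bary v) s = at_head F' (bary v) s.
  move=> sv sC; apply: FF'; first by rewrite /= sv.
  by move=> t; rewrite inE => /orP[/eqP->//|]; exact: sC.
rewrite /prism !homotE//; congr (_ - _ - _).
- exact: FF'b.
- apply: eq_subdiv => s vs; apply: FF'b; first exact: (size_flag vs).
  exact: flag_in vs vC.
- apply: eq_delta => i iv; apply: IH.
  + by rewrite size_del//; lia.
  + by move=> t /mem_del; exact: vC.
  + by move=> s; rewrite size_del// prednK//; exact: FF'b.
Qed.

Lemma prism_map (M : zmodType) i (F : seq pt -> M) v :
  prism (fun s => F (map (insert0 i) s)) v = prism F (map (insert0 i) v).
Proof.
have [n] := ubnP (size v); elim: n F v => // n IH F v.
rewrite ltnS => vn; case: (posnP (size v)) => [/size0nil ->//|v0].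
rewrite /prism [RHS]homotE ?size_map// homotE// -delta_map insert0_bary//.
rewrite -sd_map; congr (_ - _); apply: eq_delta => j jv.
rewrite -[RHS]IH//; by rewrite size_del//; lia.
Qed.

End Points.

Lemma natural_add (X Y : Type)
    (op : forall M : zmodType, (X -> M) -> Y -> M) (op_nat : natural op)
    (M : zmodType) (F G : X -> M) y :
  op M (fun x => F x + G x) y = op M F y + op M G y.
Proof.
apply/eqP; rewrite -subr_eq -(natural_sub op_nat); apply/eqP.
by congr (op M _ y); apply/funext => x; rewrite addrK.
Qed.

Lemma subdiv_relabel (T U U' : Type) (b : seq T -> U') (c : seq T -> U)
    (f' : U -> U') (M : zmodType) (F : seq U' -> M) v :
  (forall s, (0 < size s)%N -> b s = f' (c s)) ->
  subdiv c (fun s => F (map f' s)) v = subdiv b F v.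
Proof.
move=> bc; rewrite -[in RHS](map_id v); apply: subdiv_map => s s0.
by rewrite map_id bc.
Qed.

(** * Vanishing of cohomology from locally constant labels *)

Section Vanishing.
Variables (R : realType) (P : groupType) (k : nat).
Variable lab : seq P -> nat -> pt R -> option P.

Hypothesis lab_mul : forall h g i t,
  lab [seq (h * x)%g | x <- g] i t = omap (fun x => (h * x)%g) (lab g i t).
Hypothesis lab_face : forall g i j t, (j < size g)%N ->
  lab g i (insert0 j t) = lab (del j g) i t.
(* a Lebesgue number, together with local constancy of the labels *)
Hypothesis lab_small : forall g, (0 < size g)%N ->
  exists2 e : R, 0 < e & forall t, in_simplex (size g) t ->
    exists i p, (i <= k)%N /\
      forall t', in_simplex (size g) t' -> near_pt e t t' -> lab g i t' = Some p.

Definition candidate (g : seq P) (v : seq (pt R)) (i : nat) : bool :=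
  (lab g i (head (vtx R 0) v) != None) &&
  all (fun t => lab g i t == lab g i (head (vtx R 0) v)) v.

Definition index_of (g : seq P) (v : seq (pt R)) : nat :=
  find (candidate g v) (iota 0 k.+1).

(** The label is kept as an option, so that the apex of an arbitrary tuple is
    compatible with faces and with the action of [P]. *)
Definition apex (g : seq P) (v : seq (pt R)) : nat * option P :=
  (index_of g v, lab g (index_of g v) (head (vtx R 0) v)).

Definition extend (M : zmodType) (F : seq P -> M) (s : seq (option P)) : M :=
  if all isSome s then F (pmap id s) else 0.

Lemma natural_extend : natural extend.
Proof. by move=> M M' a F s; rewrite /extend; case: ifP; rewrite ?raddf0. Qed.

Lemma extend_Some (M : zmodType) (F : seq P -> M) s : extend F (map Some s) = F s.
Proof.
rewrite /extend all_map (eq_all (a2 := predT)) ?all_predT//.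
by rewrite (map_pK (f := id)).
Qed.

Lemma all_SomeP (s : seq (option P)) : all isSome s -> exists s', s = map Some s'.
Proof.
elim: s => [|[x|] s IH] //=; first by exists [::].
by move=> /IH [s' ->]; exists (x :: s').
Qed.

(** The value of [F] on the image of the tuple of points [v] under the map to
    the join: [v] is coned off successively at the apexes of its faces. *)
Definition localize (M : zmodType) (F : seq P -> M) (g : seq P)
    (v : seq (pt R)) : M :=
  subdiv (apex g) (strict_part (extend F)) v.

(** Not only [v] itself but a set closed under barycenters that contains it
    has a constant label; in this form smallness is inherited by subdivisions
    and by prisms. *)
Definition small (g : seq P) (v : seq (pt R)) : Prop :=
  exists i p (C : pt R -> Prop), [/\ (i <= k)%N, bary_closed C,
    forall t, t \in v -> C t & forall t, C t -> lab g i t = Some p].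

Lemma small_sub g v s : {subset s <= v} -> small g v -> small g s.
Proof.
move=> sv [i [p [C [ik bC vC Cp]]]]; exists i, p, C; split => // t /sv.
exact: vC.
Qed.

Lemma apexP g v : (0 < size v)%N -> small g v ->
  [/\ (index_of g v <= k)%N, isSome (apex g v).2 &
  forall t, t \in v -> lab g (index_of g v) t = (apex g v).2].
Proof.
case: v => // t0 v _ [i [p [C [ik _ vC Cp]]]].
have vp t : t \in t0 :: v -> lab g i t = Some p by move/vC/Cp.
have hasc : has (candidate g (t0 :: v)) (iota 0 k.+1).
  apply/hasP; exists i; first by rewrite mem_iota add0n ltnS leq0n ik.
  rewrite /candidate /= vp ?mem_head// eqxx /=.
  by apply/allP => t tv; rewrite vp ?inE ?tv ?orbT.
have ik' : (index_of g (t0 :: v) < k.+1)%N.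
  by rewrite /index_of -[X in (_ < X)%N](size_iota 0) -has_find.
have := nth_find 0%N hasc.
rewrite -/(index_of g (t0 :: v)) nth_iota// add0n => /andP[l0 /allP al].
split=> // [|t tv]; last by rewrite (eqP (al t tv)).
by rewrite /apex /=; case: (lab _ _ _) l0.
Qed.

(** A face has no fewer candidates than the tuple, so its least candidate is
    not larger; if the indices agree, the labels agree at a common point. *)
Lemma leidx_apex g v i : (0 < size (del i v))%N -> small g v ->
  leidx (apex g v) (apex g (del i v)).
Proof.
move=> d0 sm; have v0 : (0 < size v)%N.
  by case: v d0 {sm} => //; rewrite /del; case: i.
have smd : small g (del i v) by apply: small_sub sm => t; exact: mem_del.
have [_ _ vp] := apexP v0 sm; have [_ _ dp] := apexP d0 smd.
have : (index_of g (del i v) <= index_of g v)%N.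
  apply: sub_find => j /andP[l0 /allP vj]; apply/andP.
  have hd : head (vtx R 0) (del i v) \in del i v.
    by case: (del i v) d0 => // *; rewrite mem_head.
  split; first by rewrite (eqP (vj _ (mem_del hd))).
  by apply/allP => t td; rewrite (eqP (vj _ (mem_del td))) (eqP (vj _ (mem_del hd))).
rewrite leq_eqVlt => /orP[/eqP ii|]; [right|by left].
have td : head (vtx R 0) (del i v) \in del i v.
  by case: (del i v) d0 => // *; rewrite mem_head.
have := dp _ td; rewrite ii (vp _ (mem_del td)) => e.
by rewrite [RHS]surjective_pairing [LHS]surjective_pairing -e /= ii.
Qed.

Lemma flag_chained g v s : small g v -> flag (apex g) v s -> (0 < size v)%N ->
  [/\ all isSome (map snd s), s = apex g v :: behead s &
      chained (apex g v) (behead s)].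
Proof.
move=> sm vs; elim: vs sm => // {}v i {}s iv vs IH sm v0 /=.
have [_ -> _] := apexP v0 sm.
have smd : small g (del i v) by apply: small_sub sm => t; exact: mem_del.
case: (posnP (size (del i v))) => [d0|d0].
  by move: (size_flag vs); rewrite d0 => /size0nil ->.
have [-> e chs'] := IH smd d0; split=> //; rewrite e; split => //.
exact: leidx_apex.
Qed.

Lemma localize_delta (M : zmodType) (F : seq P -> M) g v : small g v ->
  localize (delta F) g v = delta (localize F g) v.
Proof.
move=> sm; rewrite /localize -subdiv_delta; apply: eq_subdiv => s vs.
case: (posnP (size v)) => [v0|v0].
  move: (size_flag vs); rewrite v0 => /size0nil ->; rewrite delta_nil.
  exact: delta_nil.
have [/all_SomeP [s' es'] es chs'] := flag_chained sm vs v0.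
rewrite es strict_part_delta// -es /strict_part; case: ifP => // _.
rewrite es' -delta_map extend_Some; apply: eq_delta => i _.
by rewrite extend_Some.
Qed.

Lemma path_ltidx_size (x : nat * option P) s : path (@ltidx _) x s ->
  (size s <= x.1)%N.
Proof.
elim: s x => //= y s IH x /andP[yx /IH]; rewrite /ltidx in yx *; lia.
Qed.

(** A strictly decreasing sequence of indices that starts at most at [k] has
    at most [k + 1] terms. *)
Lemma localize_vanish (M : zmodType) (F : seq P -> M) g v :
  (k.+1 < size v)%N -> small g v -> localize F g v = 0.
Proof.
move=> kv sm; rewrite -[RHS](natural0 (natural_subdiv (apex g)) M v).
apply: eq_subdiv => s vs; have v0 : (0 < size v)%N by exact: leq_ltn_trans kv.
have [_ es _] := flag_chained sm vs v0; have := size_flag vs.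
rewrite es /strict_part /=; case: ifP => // /path_ltidx_size.
have [ik _ _] := apexP v0 sm; rewrite [(apex g v).1]/= => si ss; exfalso; lia.
Qed.

Lemma localize_face (M : zmodType) (F : seq P -> M) g i v : (i < size g)%N ->
  localize F (del i g) v = localize F g (map (insert0 i) v).
Proof.
move=> ig; rewrite /localize -(subdiv_map (f' := id) (c := apex (del i g))).
  by congr (subdiv _ _ v); apply/funext => s; rewrite map_id.
move=> [//|t s] _.
have hd u : candidate g (map (insert0 i) (t :: s)) u = candidate (del i g) (t :: s) u.
  rewrite /candidate /= all_map lab_face// /= eqxx; congr (_ && _).
  by apply: eq_all => x /=; rewrite lab_face.
by rewrite /apex /index_of (eq_find hd) /= lab_face.
Qed.

Lemma localize_mul (M : zmodType) (F : seq P -> M) h g v :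
  localize F (map (fun x => (h * x)%g) g) v =
  localize (fun s => F (map (fun x => (h * x)%g) s)) g v.
Proof.
pose act (x : nat * option P) := (x.1, omap (fun y => (h * y)%g) x.2).
rewrite /localize -(subdiv_relabel (f' := act) (c := apex g)).
  congr (subdiv _ _ v); apply/funext => s; rewrite /strict_part /extend.
  have -> : sorted (@ltidx _) (map act s) = sorted (@ltidx _) s.
    by case: s => //= x s; rewrite path_map; apply: eq_path => y z.
  case: ifP => // _; rewrite -map_comp.
  have -> : all isSome (map (snd \o act) s) = all isSome (map snd s).
    by rewrite !all_map; apply: eq_all => -[? []].
  case: ifP => // _; congr F; elim: s => //= -[j [y|]] s IH //=.
  by rewrite IH.
move=> [//|t s] _.
have hd u : candidate (map (fun x => (h * x)%g) g) (t :: s) u =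
            candidate g (t :: s) u.
  rewrite /candidate /= lab_mul; rewrite !eqxx /=; congr (_ && _); first by case: (lab g u t).
  apply: eq_all => x; rewrite !lab_mul.
  by case: (lab g u x) (lab g u t) => [y|] [z|] //=; rewrite !eqE /= (inj_eq (mulgI h)).
by rewrite /apex /index_of (eq_find hd) /= lab_mul.
Qed.

Lemma natural_localize g : natural (fun M F v => @localize M F g v).
Proof.
move=> M M' a F v; rewrite /localize -natural_subdiv; congr (subdiv _ _ v).
apply/funext => s; rewrite -natural_strict_part; congr (strict_part _ s).
by apply/funext => s'; rewrite natural_extend.
Qed.

Definition fine g N := forall s, flags N (vertices R (size g)) s -> small g s.

Lemma small_flag g v s : flag (@bary R) v s -> small g v -> small g s.
Proof.
move=> vs [i [p [C [ik bC vC Cp]]]]; exists i, p, C; split => //.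
exact: flag_in vs vC.
Qed.

Lemma fineS g N : fine g N -> fine g N.+1.
Proof.
move=> fN s; move nE : N.+1 => n; move vE : (vertices _ _) => v fl.
case: fl nE vE => // {}n {}v s1 s2 vs1 s12 [nN] vE; subst n v.
exact: small_flag s12 (fN _ vs1).
Qed.

Lemma fine_exists g : exists N, fine g N.
Proof.
case: (posnP (size g)) => [g0|g0].
  exists 0%N => s /size_flags; rewrite g0 => /size0nil ->.
  by exists 0%N, 1%g, (fun=> False); split => // v v0 /(_ (head (vtx R 0) v));
    apply; case: v v0 => // *; rewrite mem_head.
have [e e0 He] := lab_small g0.
have [N Ne] : exists N, (1 - (size g)%:R^-1) ^+ N <= e.
  have c1 : `|1 - (size g)%:R^-1| < 1 :> R.
    have i0 : 0 < (size g)%:R^-1 :> R by rewrite invr_gt0 ltr0n.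
    have i1 : (size g)%:R^-1 <= 1 :> R by rewrite invf_le1 ?ler1n ?ltr0n.
    by rewrite ltr_norml; lra.
  have /cvgr0Pnorm_le /(_ e e0) [N _ HN] := cvg_expr c1.
  by exists N; apply: le_trans (HN N (leqnn N)); exact: ler_norm.
exists N => s fl; have sg := size_flags fl.
have hs : head (vtx R 0) s \in s.
  by move: g0; rewrite -(size_vertices R (size g)) -sg; case: s {fl sg} => //= *; rewrite mem_head.
have ss t : t \in s -> in_simplex (size g) t.
  by apply: (flags_in (@in_simplex_bary_closed R (size g)) fl) => x; exact: in_simplex_vertices.
have [i [p [ik Hp]]] := He _ (ss _ hs).
exists i, p, (fun t => in_simplex (size g) t /\ near_pt e (head (vtx R 0) s) t).
split => //.
- by apply: bary_closed_and; [exact: in_simplex_bary_closed|exact: near_bary_closed].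
- move=> t ts; split; first exact: ss.
  move=> j; apply: le_trans Ne; rewrite -[leRHS]mulr1.
  have := flags_contract (ler01 : 0 <= 1 :> R) _ fl hs ts.
  rewrite size_vertices; apply.
  by move=> x y /in_simplex_vertices sx /in_simplex_vertices sy; exact: in_simplex_near sx sy.
- by move=> t [st nt]; exact: Hp.
Qed.

(** Chosen as a function of the set of admissible numbers, in order to be
    invariant under the action ([mesh_mul]). *)
Definition mesh g : nat := xget 0%N [set N | fine g N].

Lemma fine_mesh g N : (mesh g <= N)%N -> fine g N.
Proof.
have [N0 fN0] := fine_exists g.
have fm : fine g (mesh g) by apply: (@xgetPex _ 0%N [set N | fine g N]); exists N0.
by move=> /subnK <-; elim: (N - mesh g)%N => // n IH; exact: fineS.
Qed.

Lemma mesh_mul h g : mesh (map (fun x => (h * x)%g) g) = mesh g.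
Proof.
rewrite /mesh; congr xget; apply/seteqP; split=> N /= fN s fl.
  have := fN s; rewrite size_map => /(_ fl) [i [p [C [ik bC sC Cp]]]].
  exists i, (h^-1 * p)%g, C; split => // t /Cp; rewrite lab_mul.
  by case: (lab g i t) => //= y [<-]; rewrite mulKg.
move: fl; rewrite size_map => /fN [i [p [C [ik bC sC Cp]]]].
by exists i, (h * p)%g, C; split => // t /Cp; rewrite lab_mul => ->.
Qed.

(** The candidate for a chain map to the join: subdivide [n] times, then
    localize. The chain rule holds at those [g] whose mesh is at most [n]
    ([refined_delta]), and [refined_prism] connects two consecutive [n]. *)
Definition refined n (M : zmodType) (F : seq P -> M) (g : seq P) : M :=
  sd_iter n (localize F g) (vertices R (size g)).

Definition refined_prism n (M : zmodType) (F : seq P -> M) (g : seq P) : M :=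
  sd_iter n (prism (localize F g)) (vertices R (size g)).

Lemma natural_refined n : natural (refined n).
Proof.
move=> M M' a F g; rewrite /refined -natural_sd_iter.
by congr (sd_iter _ _ _); apply/funext => s; rewrite natural_localize.
Qed.

Lemma natural_refined_prism n : natural (refined_prism n).
Proof.
move=> M M' a F g; rewrite /refined_prism -natural_sd_iter.
congr (sd_iter _ _ _); apply/funext => s; rewrite -natural_prism.
by congr (prism _ s); apply/funext => s'; rewrite natural_localize.
Qed.

(** The boundary in the index [g] is the boundary in the points of the
    simplex, as the faces of the simplex indexed by [g] are those indexed by
    the faces of [g]. *)
Lemma refined_faces (M : zmodType)
    (op : (seq (pt R) -> M) -> seq (pt R) -> M) (F : seq P -> M) g :
  (forall i G v, op (fun s => G (map (insert0 i) s)) v = op G (map (insert0 i) v)) ->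
  delta (fun g' => op (localize F g') (vertices R (size g'))) g =
  delta (op (localize F g)) (vertices R (size g)).
Proof.
move=> op_ins; rewrite /delta size_vertices; apply: eq_bigr => i _.
congr (_ *~ _); rewrite size_del//.
have -> : localize F (del i g) = fun v => localize F g (map (insert0 i) v).
  by apply/funext => v; rewrite localize_face.
rewrite op_ins; congr op.
by move: (nat_of_ord i) (ltn_ord i) => j; case: (size g) => // n jn; rewrite del_vertices.
Qed.

Lemma refined_delta n (M : zmodType) (F : seq P -> M) g : (mesh g <= n)%N ->
  refined n (delta F) g = delta (refined n F) g.
Proof.
move=> gn; rewrite (refined_faces (op := sd_iter n)); last first.
  by move=> i G v; exact: sd_iter_map.
rewrite -sd_iter_delta; apply: eq_sd_iter => s fl; apply: localize_delta.
exact: fine_mesh gn _ fl.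
Qed.

Lemma refined_step n (M : zmodType) (F : seq P -> M) g : (mesh g <= n)%N ->
  refined n F g - refined n.+1 F g =
  refined_prism n (delta F) g + delta (refined_prism n F) g.
Proof.
move=> gn; rewrite (refined_faces (op := fun G => sd_iter n (prism G))); last first.
  move=> i G v; rewrite -sd_iter_map; congr (sd_iter _ _ v).
  by apply/funext => s; exact: prism_map.
rewrite /refined /refined_prism /sd_iter iterSr -/(sd_iter n) -sd_iter_delta.
rewrite -(natural_sub (natural_sd_iter n)).
rewrite -(natural_add (natural_sd_iter n)).
apply: eq_sd_iter => s fl; rewrite -prismP; congr (_ + _).
have [i [p [C [ik bC sC Cp]]]] := fine_mesh gn fl.
apply/esym; apply: (eq_prism bC sC) => s' _ s'C; apply: localize_delta.
by exists i, p, C.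
Qed.

(** The prism raises the length of tuples by one, so here length [k + 1]
    suffices. *)
Lemma refined_prism_vanish n (M : zmodType) (F : seq P -> M) g :
  (k < size g)%N -> (mesh g <= n)%N -> refined_prism n F g = 0.
Proof.
move=> kg gn; rewrite -[RHS](natural0 (natural_sd_iter n) M (vertices R (size g))).
apply: eq_sd_iter => s fl; rewrite -[RHS](natural0 (@natural_prism R) M s).
have [i [p [C [ik bC sC Cp]]]] := fine_mesh gn fl.
apply: (eq_prism bC sC) => s' ss' s'C; apply: localize_vanish.
  by rewrite ss' (size_flags fl) size_vertices.
by exists i, p, C.
Qed.

Lemma refined_mul n (M : zmodType) (F : seq P -> M) h g :
  refined n F (map (fun x => (h * x)%g) g) =
  refined n (fun s => F (map (fun x => (h * x)%g) s)) g.
Proof.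
rewrite /refined size_map; congr (sd_iter _ _ _); apply/funext => v.
exact: localize_mul.
Qed.

Lemma refined_prism_mul n (M : zmodType) (F : seq P -> M) h g :
  refined_prism n F (map (fun x => (h * x)%g) g) =
  refined_prism n (fun s => F (map (fun x => (h * x)%g) s)) g.
Proof.
rewrite /refined_prism size_map; congr (sd_iter _ (prism _) _).
by apply/funext => v; exact: localize_mul.
Qed.

Definition telescope_prism n (M : zmodType) (F : seq P -> M) (g : seq P) : M :=
  \sum_(0 <= j < n | (mesh g <= j)%N) refined_prism j F g.

Lemma natural_telescope_prism n : natural (telescope_prism n).
Proof.
move=> M M' a F g; rewrite /telescope_prism raddf_sum; apply: eq_bigr => j _.
by rewrite natural_refined_prism.
Qed.

Lemma telescope_prismS n (M : zmodType) (F : seq P -> M) g : (mesh g <= n)%N ->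
  telescope_prism n.+1 F g = telescope_prism n F g + refined_prism n F g.
Proof. by move=> gn; rewrite /telescope_prism big_mkcond big_nat_recr//= gn -big_mkcond. Qed.

(** A level that is admissible for [g] and for all its iterated faces. *)
Fixpoint depth_rec n (g : seq P) : nat :=
  if n is n'.+1
  then maxn (mesh g) (\max_(i < size g) depth_rec n' (del i g)) else mesh g.

Definition depth (g : seq P) : nat := depth_rec (size g) g.

Lemma mesh_depth g : (mesh g <= depth g)%N.
Proof. by rewrite /depth; case: (size g) => //= n; rewrite leq_maxl. Qed.

Lemma depth_del i g : (i < size g)%N -> (depth (del i g) <= depth g)%N.
Proof.
move=> ig; rewrite /depth size_del//; case sg : (size g) ig => [//|n] ig /=.
rewrite leq_max sg; apply/orP; right.
exact: (@leq_bigmax _ (fun i : 'I_n.+1 => depth_rec n (del i g)) (Ordinal ig)).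
Qed.

(** The operator at level [n], corrected by the boundary of the telescope. The
    correction leads from level [n] back to [mesh g], and on each face it
    interpolates between [mesh g] and the mesh of the face; hence the value is
    independent of [n] once [n] is large ([reduction_atS]). *)
Definition reduction_at n (M : zmodType) (F : seq P -> M) (g : seq P) : M :=
  refined n F g + delta (telescope_prism n F) g + telescope_prism n (delta F) g.

Lemma reduction_atS n (M : zmodType) (F : seq P -> M) g : (depth g <= n)%N ->
  reduction_at n.+1 F g = reduction_at n F g.
Proof.
move=> gn; have mg := leq_trans (mesh_depth g) gn.
rewrite /reduction_at telescope_prismS//.
have -> : delta (telescope_prism n.+1 F) g =
    delta (telescope_prism n F) g + delta (refined_prism n F) g.
  rewrite -delta_add; apply: eq_delta => i ig; apply: telescope_prismS.
  exact: leq_trans (mesh_depth _) (leq_trans (depth_del ig) gn).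
have /eqP := refined_step F mg; rewrite subr_eq => /eqP ->.
rewrite [X in _ = X + _ + _]addrC -!addrA; congr (_ + _).
by rewrite [RHS]addrC -!addrA addrCA.
Qed.

Definition reduction (M : zmodType) (F : seq P -> M) (g : seq P) : M :=
  reduction_at (depth g) F g.

Lemma reductionE n (M : zmodType) (F : seq P -> M) g : (depth g <= n)%N ->
  reduction F g = reduction_at n F g.
Proof.
move=> /subnK <-; elim: (n - _)%N => // m ->.
by rewrite addSn reduction_atS// leq_addl.
Qed.

Lemma natural_reduction : natural reduction.
Proof.
move=> M M' a F g; rewrite /reduction /reduction_at natural_refined !raddfD; congr (_ + _ + _).
  rewrite -natural_delta; apply: eq_delta => i _.
  by rewrite natural_telescope_prism.
rewrite -natural_telescope_prism; congr (telescope_prism _ _ _).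
by apply/funext => s; rewrite natural_delta.
Qed.

Lemma reduction_nil (M : zmodType) (F : seq P -> M) : reduction F [::] = F [::].
Proof.
have sd0 n (G : seq (pt R) -> M) : sd_iter n G [::] = G [::].
  by elim: n.
rewrite /reduction /reduction_at delta_nil addr0 /telescope_prism big1 ?addr0.
  by rewrite /refined sd0.
by move=> i _; rewrite /refined_prism sd0.
Qed.

(** Once the same large level is used for [g] and its faces, this is the chain
    rule for [refined] and delta^2 = 0. *)
Lemma reduction_delta (M : zmodType) (F : seq P -> M) g :
  reduction (delta F) g = delta (reduction F) g.
Proof.
have -> : delta (reduction F) g = delta (reduction_at (depth g) F) g.
  by apply: eq_delta => i ig; apply: reductionE; exact: depth_del.
rewrite /reduction /reduction_at !delta_add delta_delta addr0 -refined_delta ?mesh_depth//.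
have -> : delta (delta F) = fun=> 0 by apply/funext => s; exact: delta_delta.
by rewrite (natural0 (natural_telescope_prism _)) addr0.
Qed.

Lemma reduction_vanish (M : zmodType) (F : seq P -> M) g :
  (k.+1 < size g)%N -> reduction F g = 0.
Proof.
move=> kg; have tp0 n (G : seq P -> M) g' : (k < size g')%N ->
    telescope_prism n G g' = 0.
  by move=> kg'; apply: big1 => j gj; exact: refined_prism_vanish.
rewrite /reduction /reduction_at tp0 1?ltnW// delta0 => [|i ig]; last first.
  by apply: tp0; rewrite size_del//; lia.
rewrite !addr0 -[RHS](natural0 (natural_sd_iter (depth g)) M (vertices R (size g))).
apply: eq_sd_iter => s fl; apply: localize_vanish.
  by rewrite (size_flags fl) size_vertices.
exact: fine_mesh (mesh_depth g) _ fl.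
Qed.

Lemma depth_mul h g : depth (map (fun x => (h * x)%g) g) = depth g.
Proof.
rewrite /depth size_map; move: (size g) => n; elim: n g => [|n IH] g /=.
  exact: mesh_mul.
rewrite mesh_mul size_map; congr maxn; apply: eq_bigr => i _.
by rewrite -map_del IH.
Qed.

Lemma reduction_mul (M : zmodType) (F : seq P -> M) h g :
  reduction F (map (fun x => (h * x)%g) g) =
  reduction (fun s => F (map (fun x => (h * x)%g) s)) g.
Proof.
have tpm n (G : seq P -> M) g' :
    telescope_prism n G (map (fun x => (h * x)%g) g') =
    telescope_prism n (fun s => G (map (fun x => (h * x)%g) s)) g'.
  rewrite /telescope_prism mesh_mul; apply: eq_bigr => j _.
  exact: refined_prism_mul.
rewrite /reduction /reduction_at depth_mul refined_mul tpm; congr (_ + _ + _).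
  by rewrite -delta_map; apply: eq_delta => i _; exact: tpm.
congr (telescope_prism _ _ g); apply/funext => s; by rewrite delta_map.
Qed.

(** The tuples of [P] form a free acyclic complex, contracted by repeating the
    first entry; so every natural cochain map that preserves the augmentation
    is homotopic to the identity. *)
Definition primitive (M : zmodType) : (seq P -> M) -> seq P -> M :=
  homot (head 1%g) reduction (M := M).

Lemma primitiveP (M : zmodType) (F : seq P -> M) g : (forall s, delta F s = 0) ->
  (k.+1 < size g)%N -> F g = delta (primitive F) g.
Proof.
move=> dF kg; have := homotP (head 1%g) natural_reduction reduction_nil reduction_delta F g.
have -> : delta F = fun=> 0 by apply/funext.
by rewrite (natural0 (natural_homot _ natural_reduction)) add0r reduction_vanish// subr0.
Qed.

Lemma primitive_mul (M : zmodType) (F : seq P -> M) h g :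
  primitive F (map (fun x => (h * x)%g) g) =
  primitive (fun s => F (map (fun x => (h * x)%g) s)) g.
Proof.
have [n] := ubnP (size g); elim: n F g => // n IH F g; rewrite ltnS => gn.
case: (posnP (size g)) => [/size0nil ->//|g0].
have hd : head 1%g (map (fun x => (h * x)%g) g) = (h * head 1 g)%g.
  by case: g g0 {gn}.
rewrite /primitive homotE ?size_map// homotE// hd reduction_mul -delta_map.
congr (_ - _ - _); apply: eq_delta => i ig; apply: IH.
by rewrite size_del//; lia.
Qed.

(** If [f] is a cocycle of degree [n > k], then [f] is the coboundary of
    [primitive f] up to [reduction f], and the latter is zero on tuples of
    length [n + 1]. The rest of the proof passes from functions of finite
    families to functions of sequences. *)
Theorem cohomology_trivial_of_labels n (M : gmodule P) : (k < n)%N ->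
  cohomology_trivial M n.
Proof.
case: n => // n kn f [f_eq f_coc]; rewrite /coboundary.
pose F (s : seq P) : M := if size s == n.+2 then f (fun i => nth 1%g s i) else 0.
have size_tuple m (g : 'I_m -> P) : size (map g (enum 'I_m)) = m.
  by rewrite size_map size_enum_ord.
have nthE m (g : 'I_m -> P) (i : 'I_m) : nth 1%g (map g (enum 'I_m)) i = g i.
  by rewrite (nth_map i) ?size_enum_ord// nth_ord_enum.
have del_tuple m (g : 'I_m.+1 -> P) (i : 'I_m.+1) :
    del i (map g (enum 'I_m.+1)) = map (g \o lift i) (enum 'I_m).
  apply: (@eq_from_nth _ 1%g).
    by rewrite size_del size_tuple ?size_tuple ?ltn_ord.
  move=> j; rewrite size_del size_tuple ?ltn_ord// => jm.
  rewrite nth_del; have /= -> := nthE _ (g \o lift i) (Ordinal jm).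
  exact: (nthE _ g (lift i (Ordinal jm))).
have codiffE m (G : seq P -> M) (g : 'I_m.+2 -> P) :
    codiff (fun x : 'I_m.+1 -> P => G (map x (enum 'I_m.+1))) g =
    delta G (map g (enum 'I_m.+2)).
  rewrite /codiff /delta size_tuple; apply: eq_bigr => i _.
  by rewrite del_tuple.
have Ff (x : 'I_n.+2 -> P) : F (map x (enum 'I_n.+2)) = f x.
  by rewrite /F size_tuple eqxx; congr f; apply/funext => i; rewrite nthE.
have dF s : delta F s = 0.
  case: (eqVneq (size s) n.+3) => [sn|sn]; last first.
    apply: delta0 => i si; rewrite /F size_del//.
    move/eqP in sn; case: eqP => // e; exfalso; apply: sn.
    by rewrite -e prednK//; exact: leq_ltn_trans si.
  have es : s = map (fun i : 'I_n.+3 => nth 1%g s i) (enum 'I_n.+3).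
    apply: (@eq_from_nth _ 1%g); first by rewrite size_tuple.
    move=> i; rewrite sn => i_n.
    by rewrite (nth_map (Ordinal i_n)) ?size_enum_ord// (nth_ord_enum _ (Ordinal i_n)).
  rewrite es -codiffE -[RHS](f_coc (fun i => nth 1%g s i)).
  by congr codiff; apply/funext => x; rewrite Ff.
exists (fun x : 'I_n.+1 -> P => primitive F (map x (enum 'I_n.+1))); last first.
  move=> g; rewrite codiffE -Ff; apply: primitiveP dF _.
  by rewrite size_tuple.
move=> h g; rewrite (map_comp (fun x => (h * x)%g) g) primitive_mul.
have act_additive : zmod_morphism (@gact P M h).
  have a0 : gact h (0 : M) = 0.
    by apply: (addrI (gact h (0 : M))); rewrite -gactD !addr0.
  move=> x y; rewrite gactD; congr (_ + _); apply: (addrI (gact h y)).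
  by rewrite -gactD !subrr.
pose a : {additive M -> M} :=
  HB.pack (@gact P M h) (GRing.isZmodMorphism.Build _ _ _ act_additive).
rewrite -[RHS]/(a _) -(natural_homot _ natural_reduction a).
congr (homot _ _ _ _); apply/funext => s; rewrite /F size_map.
case: eqP => [sn|]; last by rewrite raddf0.
rewrite -[RHS]f_eq; congr f; apply/funext => i.
by rewrite (nth_map 1%g)// sn.
Qed.

End Vanishing.

(** * Continuity of maps between intervals, simplices and paths *)

Section Continuity.
Variable R : realType.
Local Notation pt := (pt R).
Local Notation I := (I01 R).

Lemma pt_continuous (T : topologicalType) (f : T -> pt) :
  (forall i, continuous (fun x => f x i)) -> continuous f.
Proof.
move=> fc x; apply/(@pointwise_cvgP nat R) => i; exact: fc.
Qed.

Lemma pt_coord_cont i : continuous (fun t : pt => t i).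
Proof. exact: (@proj_continuous nat (fun=> R) i). Qed.

Lemma pt_hausdorff : hausdorff_space pt.
Proof. by apply: (@hausdorff_product nat (fun=> R)) => i; exact: norm_hausdorff. Qed.

Lemma comp_cont (S T U : topologicalType) (f : S -> T) (g : T -> U) :
  continuous f -> continuous g -> continuous (fun x => g (f x)).
Proof. by move=> fc gc x; apply: continuous_comp; [exact: fc|exact: gc]. Qed.

Lemma pair_cont (S T U : topologicalType) (f : S -> T) (g : S -> U) :
  continuous f -> continuous g -> continuous (fun x => (f x, g x)).
Proof. by move=> fc gc x; apply: cvg_pair; [exact: fc|exact: gc]. Qed.

Lemma fst_cont (S T : topologicalType) : continuous (@fst S T).
Proof. by move=> x; exact: cvg_fst. Qed.

Lemma snd_cont (S T : topologicalType) : continuous (@snd S T).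
Proof. by move=> x; exact: cvg_snd. Qed.

Lemma cst_cont (S T : topologicalType) (y : T) : continuous (fun _ : S => y).
Proof. by move=> x; exact: cvg_cst. Qed.

Lemma id_cont (T : topologicalType) : continuous (fun x : T => x).
Proof. by move=> x; exact: cvg_id. Qed.

Lemma set_val_cont (T : topologicalType) (A : set T) :
  continuous (set_val : set_type A -> T).
Proof. exact: initial_continuous. Qed.

Lemma into_set_type (S T : topologicalType) (A : set T) (f : S -> set_type A) :
  continuous (fun x => set_val (f x)) -> continuous f.
Proof. exact: continuous_comp_initial. Qed.

Lemma slice_cont (S T : topologicalType) (f : S -> I -> T) s :
  continuous (fun x : S * I => f x.1 x.2) -> continuous (f s).
Proof.
move=> fc; apply: (@comp_cont _ _ _ (fun r : I => (s, r)) _ _ fc).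
by apply: pair_cont; [exact: cst_cont|exact: id_cont].
Qed.

Section Real.
Variables (T : topologicalType) (f g : T -> R).
Hypotheses (fc : continuous f) (gc : continuous g).
Lemma addr_cont : continuous (fun x => f x + g x).
Proof. by move=> x; apply: cvgD; [exact: fc|exact: gc]. Qed.
Lemma subr_cont : continuous (fun x => f x - g x).
Proof. by move=> x; apply: cvgB; [exact: fc|exact: gc]. Qed.
Lemma mulr_cont : continuous (fun x => f x * g x).
Proof. by move=> x; apply: cvgM; [exact: fc|exact: gc]. Qed.
Lemma maxr_cont : continuous (fun x => Num.max (f x) (g x)).
Proof. by move=> x; apply: continuous_max; [exact: fc|exact: gc]. Qed.
Lemma minr_cont : continuous (fun x => Num.min (f x) (g x)).
Proof. by move=> x; apply: continuous_min; [exact: fc|exact: gc]. Qed.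
Lemma invr_cont : (forall x, f x != 0) -> continuous (fun x => (f x)^-1).
Proof. by move=> f0 x; apply: cvgV => //; exact: fc. Qed.
End Real.

Lemma sumr_cont (T : topologicalType) (n : nat) (f : nat -> T -> R) :
  (forall i, continuous (f i)) -> continuous (fun x => \sum_(i < n) f i x).
Proof.
move=> fc; elim: n => [|n IH].
  by under eq_fun do rewrite big_ord0; exact: cst_cont.
by under eq_fun do rewrite big_ord_recr; apply: addr_cont.
Qed.

Lemma clip_cont : continuous (@clip R).
Proof.
apply: into_set_type; apply: maxr_cont; first exact: cst_cont.
by apply: minr_cont; [exact: cst_cont|move=> x; exact: cvg_id].
Qed.

Lemma I01_ge0 (s : I) : 0 <= (set_val s : R).
Proof. by have := set_valP s; rewrite /= in_itv /= => /andP[]. Qed.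

Lemma I01_le1 (s : I) : (set_val s : R) <= 1.
Proof. by have := set_valP s; rewrite /= in_itv /= => /andP[]. Qed.

Lemma clip_val (r : R) : 0 <= r <= 1 -> set_val (clip r) = r.
Proof.
move=> /andP[r0 r1]; rewrite set_valE /=. by rewrite (min_idPr r1) (max_idPr r0).
Qed.

Lemma val_clip (s : I) : clip (set_val s) = s.
Proof. by apply/val_inj; rewrite -[LHS]/(set_val _) clip_val// I01_ge0 I01_le1. Qed.

Lemma compact_set_type (T : topologicalType) (A : set T) :
  compact A -> compact [set: set_type A].
Proof.
move=> cA F FF _; pose G := (set_val : set_type A -> T) @ F.
have GA : G A.
  rewrite /G /=; apply: (@filterE _ F _) => x; exact: (set_valP x).
have [x [Ax xG]] := cA G _ GA.
exists (exist _ x (mem_set Ax)); split=> // B C FB [C' [[D oD <-] Dx] DC].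
have /= [] := xG (set_val @` B) D.
- by rewrite /G /=; apply: filterS FB => y By; exists y.
- by rewrite nbhsE /=; exists D.
by move=> _ [[y By <-] Dy]; exists y; split=> //; exact: DC.
Qed.

Lemma I01_compact : compact [set: I].
Proof. exact/compact_set_type/segment_compact. Qed.

Lemma I01_hausdorff : hausdorff_space I.
Proof.
move=> x y xy; apply/val_inj; apply: (@norm_hausdorff R R) => A B Ax By.
have [z [Az Bz]] := xy _ _ (set_val_cont Ax) (set_val_cont By).
by exists (set_val z).
Qed.

Lemma paste_cont (T X : topologicalType) n (A : nat -> set T)
    (g : nat -> T -> X) (f : T -> X) :
  (forall j, closed (A j)) ->
  (forall j, (j < n)%N -> continuous (g j)) ->
  (forall j t, (j < n)%N -> A j t -> f t = g j t) ->
  (forall t, exists2 j, (j < n)%N & A j t) -> continuous f.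
Proof.
move=> cA gc fg cov; apply/continuous_closedP => Z cZ.
have -> : f @^-1` Z = \bigcup_(j in `I_n) (A j `&` g j @^-1` Z).
  apply/seteqP; split => t /=.
    by move=> Zt; have [j jn At] := cov t; exists j => //; split => //; rewrite /= -fg.
  by move=> [j /= jn [At]]; rewrite -fg.
apply: closed_bigcup; first exact: finite_II.
move=> j /= jn; apply: closedI => //.
by have /continuous_closedP := gc j jn; apply.
Qed.

(** A map out of a compact space onto a simplex, which is Hausdorff, is a
    quotient map, so continuous maps that are constant on its fibres descend.
    Composition with the retraction extends the result to all sequences, which
    spares all later maps a domain of definition. *)
Lemma descend (C : topologicalType) (X : topologicalType) (q : C -> pt)
    (retraction : pt -> pt) (H : C -> X) :
  compact [set: C] -> continuous q -> continuous retraction -> continuous H ->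
  (forall t, exists c, q c = retraction t) ->
  (forall c c', q c = q c' -> H c = H c') ->
  exists2 F : pt -> X, continuous F & forall c, retraction (q c) = q c -> F (q c) = H c.
Proof.
move=> cC qc rc Hc qsurj Hq.
have /choice [sec secP] := qsurj.
exists (fun t => H (sec t)); last by move=> c rq; apply: Hq; rewrite secP.
apply/continuous_closedP => Z cZ.
have -> : (fun t => H (sec t)) @^-1` Z = retraction @^-1` (q @` (H @^-1` Z)).
  apply/seteqP; split => t /=; first by move=> Zt; exists (sec t).
  by move=> [c Zc qr]; rewrite (Hq _ c)// secP.
have /continuous_closedP := rc; apply; apply: compact_closed; first exact: pt_hausdorff.
apply: continuous_compact; first exact: continuous_subspaceT.
apply: (@subclosed_compact _ _ [set: C]) => //.
by have /continuous_closedP := Hc; apply.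
Qed.

(** Continuous families of paths can be concatenated: paste along the closed
    sets on which the time is at most, respectively at least, one half. *)
Lemma concat_cont (S X : topologicalType) (p q : S -> I -> X) :
  continuous (fun x : S * I => p x.1 x.2) ->
  continuous (fun x : S * I => q x.1 x.2) ->
  (forall s, p s (clip 1) = q s (clip 0)) ->
  continuous (fun x : S * I => concat (p x.1) (q x.1) x.2).
Proof.
move=> pc qc pq.
have vc : continuous (fun x : S * I => set_val x.2 : R).
  by apply: comp_cont (@set_val_cont _ _); exact: snd_cont.
have v2c : continuous (fun x : S * I => 2 * set_val x.2 : R).
  by apply: mulr_cont vc; exact: cst_cont.
pose A j := if j is 0 then [set x : S * I | (set_val x.2 : R) <= 2^-1]
            else [set x : S * I | (set_val x.2 : R) >= 2^-1].
pose g j (x : S * I) := if j is 0 then p x.1 (clip (2 * set_val x.2))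
            else q x.1 (clip (2 * set_val x.2 - 1)).
apply: (@paste_cont _ _ 2 A g).
- case=> [|j]; rewrite /A.
    by have /continuous_closedP /(_ _ (@closed_le R 2^-1)) := vc.
  by have /continuous_closedP /(_ _ (@closed_ge R 2^-1)) := vc.
- move=> [|j] _; rewrite /g.
    refine (@comp_cont _ _ _ (fun x : S * I => (x.1, clip (2 * set_val x.2))) _ _ pc).
    apply: pair_cont; first exact: fst_cont.
    exact: (comp_cont v2c clip_cont).
  refine (@comp_cont _ _ _ (fun x : S * I => (x.1, clip (2 * set_val x.2 - 1))) _ _ qc).
  apply: pair_cont; first exact: fst_cont.
  apply: (comp_cont _ clip_cont); apply: subr_cont => //; exact: cst_cont.
- move=> [|j] x _; rewrite /A /g /concat /=; first by move=> ->.
  move=> ge; case: ifPn => // le; have e : set_val x.2 = 2^-1 :> R by lra.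
  by rewrite e divff ?pnatr_eq0// subrr pq.
- move=> x; case: (leP (set_val x.2 : R) 2^-1) => h; first by exists 0%N.
  by exists 1%N => //=; exact: ltW.
Qed.

Lemma concat_path_cont (X : topologicalType) (p q : I -> X) :
  continuous p -> continuous q -> p (clip 1) = q (clip 0) ->
  continuous (concat p q).
Proof.
move=> pc qc pq; apply: (@slice_cont I X (fun=> concat p q) (clip 0)).
apply: (@concat_cont I X (fun=> p) (fun=> q)) => //.
- exact: (comp_cont (@snd_cont _ _) pc).
- exact: (comp_cont (@snd_cont _ _) qc).
Qed.

End Continuity.

(** * Filling the boundary of a simplex *)

Section Geometry.
Variable R : realType.
Local Notation pt := (pt R).
Local Notation I := (I01 R).

Definition in_boundary n (t : pt) : Prop :=
  in_simplex n t /\ exists2 i, (i < n)%N & t i = 0.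

Definition possum n (t : pt) : R := \sum_(i < n.+1) Num.max 0 (t i).

(** Replace coordinates by their positive parts, make up for a sum below one
    in the first coordinate, and divide by a sum above one. *)
Definition retraction n (t : pt) : pt := fun i =>
  if (i < n.+1)%N then
    (Num.max 0 (t i) + (i == 0)%:R * Num.max 0 (1 - possum n t))
      / Num.max 1 (possum n t)
  else 0.

Lemma possum_cont n : continuous (possum n).
Proof.
apply: (@sumr_cont R pt n.+1 (fun i t => Num.max 0 (t i))) => i.
by apply: maxr_cont; [exact: cst_cont|exact: pt_coord_cont].
Qed.

Lemma retraction_cont n : continuous (retraction n).
Proof.
apply: pt_continuous => i; rewrite /retraction; case: (i < n.+1)%N; last exact: cst_cont.
apply: mulr_cont; first apply: addr_cont.
- by apply: maxr_cont; [exact: cst_cont|exact: pt_coord_cont].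
- apply: mulr_cont; first exact: cst_cont.
  apply: maxr_cont; first exact: cst_cont.
  by apply: subr_cont; [exact: cst_cont|exact: possum_cont].
- apply: invr_cont; last by move=> t; rewrite gt_eqF// lt_max ltr01.
  by apply: maxr_cont; [exact: cst_cont|exact: possum_cont].
Qed.

Lemma possum_ge0 n t : 0 <= possum n t.
Proof. by apply: sumr_ge0 => i _; rewrite le_max lexx. Qed.

Lemma retraction_simp n t : in_simplex n.+1 (retraction n t).
Proof.
have M0 : 0 < Num.max 1 (possum n t) by rewrite lt_max ltr01.
split=> [i|i|]; rewrite /retraction.
- case: ifP => // _; apply: divr_ge0; last exact: ltW.
  by rewrite addr_ge0 ?mulr_ge0 ?ler0n// le_max lexx.
- by rewrite leqNgt => /negbTE ->.
- under eq_bigr => i _ do rewrite ltn_ord.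
  rewrite -mulr_suml big_split /= -/(possum n t) -mulr_suml.
  rewrite big_ord_recl /= big1// addr0 mul1r.
  case: (leP (possum n t) 1) => h.
    by rewrite max_r ?subr_ge0// addrC subrK divr1.
  by rewrite max_l ?addr0 ?divff ?gt_eqF ?possum_ge0// ?subr_le0 ?ltW// (lt_trans _ h).
Qed.

Lemma retraction_id n t : in_simplex n.+1 t -> retraction n t = t.
Proof.
move=> [t0 tn t1]; have pos i : Num.max 0 (t i) = t i by rewrite max_r.
have S1 : possum n t = 1 by rewrite /possum; under eq_bigr do rewrite pos.
apply/funext => i; rewrite /retraction S1 maxxx subrr maxxx mulr0 addr0 divr1 pos.
by case: ltnP => // /tn ->.
Qed.

(** The distance to the boundary of the simplex, up to a factor: it is zero
    exactly on the boundary and [1 / n.+1] at the barycenter. *)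
Fixpoint mincoord n (t : pt) : R :=
  if n is n'.+1 then Num.min (mincoord n' t) (t n) else t 0%N.

Lemma mincoord_cont n : continuous (mincoord n).
Proof.
elim: n => [|n IH] /=; first exact: pt_coord_cont.
by apply: minr_cont => //; exact: pt_coord_cont.
Qed.

Lemma mincoord_le n t i : (i < n.+1)%N -> mincoord n t <= t i.
Proof.
elim: n => [|n IH] /=; first by case: i.
rewrite ltnS leq_eqVlt => /orP[/eqP ->|/IH h]; first by rewrite ge_min lexx orbT.
by rewrite ge_min h.
Qed.

Lemma mincoord_attained n t : exists2 i, (i < n.+1)%N & t i = mincoord n t.
Proof.
elim: n => [|n [i i_n ti]] /=; first by exists 0%N.
case: (leP (mincoord n t) (t n.+1)) => h.
  by exists i => //; exact: ltnW.
by exists n.+1.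
Qed.

Lemma mincoord_ge n t x : (forall i, (i < n.+1)%N -> x <= t i) -> x <= mincoord n t.
Proof. by move=> h; have [i /h + <-] := mincoord_attained n t. Qed.

Lemma mincoordE n t x i : (i < n.+1)%N -> t i = x ->
  (forall j, (j < n.+1)%N -> x <= t j) -> mincoord n t = x.
Proof.
move=> i_n <- h; apply/eqP; rewrite eq_le mincoord_le//=; exact: mincoord_ge.
Qed.

Lemma scaled_min_bounds n t : in_simplex n.+1 t ->
  0 <= n.+1%:R * mincoord n t <= 1.
Proof.
move=> [t0 tn t1]; rewrite mulr_ge0 ?ler0n ?mincoord_ge//=.
rewrite -[leRHS]t1 mulr_natl -[X in _ *+ X]card_ord -sumr_const.
by apply: ler_sum => i _; exact: mincoord_le.
Qed.

(** The cube of dimension [n] is mapped onto the simplex of the same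
    dimension, by induction: the product of the smaller simplex with an
    interval maps onto the cone over that simplex, and the end of the product
    is collapsed to the new vertex. The map is injective off the boundary, and
    the preimage of the boundary is the boundary. *)
Fixpoint collapse n (x : nat -> R) : pt :=
  if n is n'.+1 then
    fun i => if (i < n)%N then (1 - x n') * collapse n' x i
             else if i == n then x n' else 0
  else vtx R 0.

Lemma collapse_cont (T : topologicalType) n (x : T -> nat -> R) :
  (forall i, continuous (fun s => x s i)) ->
  continuous (fun s => collapse n (x s)).
Proof.
move=> xc; elim: n => [|n IH]; first exact: cst_cont.
apply: pt_continuous => i /=; case: (i < n.+1)%N.
  apply: mulr_cont; first by apply: subr_cont => //; exact: cst_cont.
  exact: (comp_cont IH (@pt_coord_cont R i)).
by case: (i == n.+1) => //; exact: cst_cont.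
Qed.

Definition in_cube n (x : nat -> R) := forall i, (i < n)%N -> 0 <= x i <= 1.

Lemma in_cubeS n x : in_cube n.+1 x -> in_cube n x.
Proof. by move=> xc i i_n; apply: xc; exact: ltnW. Qed.

Lemma collapse_simp n x : in_cube n x -> in_simplex n.+1 (collapse n x).
Proof.
elim: n => [|n IH] xc; first exact: in_simplex_vtx.
have [c0 cn c1] := IH (in_cubeS xc); have /andP[x0 x1] := xc n (ltnSn n).
split=> [i|i|] /=.
- case: ifP => _; first by rewrite mulr_ge0// subr_ge0.
  by case: ifP.
- by case: ltngtP => //; lia.
- rewrite big_ord_recr /= ltnn eqxx.
  under eq_bigr => i _ do rewrite ltn_ord.
  by rewrite -mulr_sumr c1 mulr1 subrK.
Qed.

Lemma collapse_agree n (x x' : nat -> R) : (forall i, (i < n)%N -> x i = x' i) ->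
  collapse n x = collapse n x'.
Proof.
by elim: n => //= n IH xx'; rewrite xx'// IH// => i i_n; apply: xx'; exact: ltnW.
Qed.

Lemma collapse_surj n t : in_simplex n.+1 t -> exists2 x, in_cube n x & collapse n x = t.
Proof.
elim: n t => [|n IH] t [t0 tn t1].
  exists (fun=> 0) => //; apply/funext => i /=; rewrite /vtx.
  move: t1; rewrite big_ord_recl big_ord0 addr0 /= => t1.
  by case: i => [|i] /=; [rewrite t1|rewrite tn].
have tl1 : t n.+1 <= 1 by apply: (@in_simplex_le1 _ n.+2); split.
case: (eqVneq (t n.+1) 1) => [e|ne].
  exists (fun=> 1) => [i _|]; first by rewrite ler01 lexx.
  apply/funext => i /=; rewrite subrr mul0r.
  case: ltngtP => [i_n|ni|->]; last by [].
    apply/esym/eqP; have : \sum_(j < n.+1) t j = 0.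
      apply: (addIr 1); rewrite add0r -[RHS]t1 [in RHS]big_ord_recr /= e.
      by congr (_ + _); apply: eq_bigr.
    move/eqP; rewrite psumr_eq0 => [/allP /(_ (Ordinal i_n))|? _]; last exact: t0.
    by apply; rewrite mem_index_enum.
  by rewrite tn.
have d0 : 0 < 1 - t n.+1 by rewrite subr_gt0 lt_neqAle ne.
have e1 : \sum_(i < n.+1) t i = 1 - t n.+1.
  apply: (addIr (t n.+1)); rewrite subrK -[RHS]t1 [in RHS]big_ord_recr.
  by congr (_ + _); apply: eq_bigr.
pose u : pt := fun i => if (i < n.+1)%N then t i / (1 - t n.+1) else 0.
have su : in_simplex n.+1 u.
  split=> [i|i|]; rewrite /u.
  - by case: ifP => // _; rewrite divr_ge0// ltW.
  - by rewrite leqNgt => /negbTE ->.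
  - under eq_bigr => i _ do rewrite ltn_ord.
    by rewrite -mulr_suml e1 divff// gt_eqF.
have [x xc cx] := IH _ su.
exists (fun i => if (i < n)%N then x i else t n.+1).
  by move=> i _; case: ifP => [/xc//|_]; rewrite t0 tl1.
apply/funext => i /=; rewrite ltnn.
rewrite (collapse_agree (x' := x)) => [|j ->//]; rewrite cx /u.
case: ltngtP => [i_n|ni|->] //; last by rewrite tn.
by rewrite mulrC divfK// gt_eqF.
Qed.

Lemma collapse_bdry n x i : (i < n)%N -> x i = 0 \/ x i = 1 ->
  exists2 j, (j < n.+1)%N & collapse n x j = 0.
Proof.
elim: n => // n IH; rewrite ltnS leq_eqVlt => /orP[/eqP ->|i_n] xi.
  case: xi => e; first by exists n.+1 => //=; rewrite ltnn eqxx e.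
  by exists 0%N => //=; rewrite e subrr mul0r.
have [j jn cj] := IH i_n xi; exists j; first exact: ltnW.
by rewrite /= jn cj mulr0.
Qed.

Lemma collapse_zero n x j : (j < n.+1)%N -> collapse n x j = 0 ->
  exists2 i, (i < n)%N & x i = 0 \/ x i = 1.
Proof.
elim: n j => [|n IH] j.
  by case: j => // _ /eqP; rewrite /= /vtx eqxx oner_eq0.
rewrite ltnS leq_eqVlt => /orP[/eqP ->|jn] /=.
  by rewrite ltnn eqxx => e; exists n => //; left.
rewrite jn => /eqP; rewrite mulf_eq0 subr_eq0 => /orP[/eqP e|/eqP e].
  by exists n => //; right.
by have [i i_n xi] := IH _ jn e; exists i => //; exact: ltnW.
Qed.

Lemma collapse_inj n x x' : (forall j, (j < n.+1)%N -> collapse n x j != 0) ->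
  collapse n x = collapse n x' -> forall i, (i < n)%N -> x i = x' i.
Proof.
elim: n => // n IH nz e i.
have en : x n = x' n by have := congr1 (@^~ n.+1) e; rewrite /= ltnn eqxx.
rewrite ltnS leq_eqVlt => /orP[/eqP ->//|i_n]; apply: IH i_n.
  move=> j jn; apply/negP => /eqP cj; have := nz j (ltnW jn).
  by rewrite /= jn cj mulr0 eqxx.
apply/funext => j; case: (ltnP j n.+1) => [jn|nj].
  have := congr1 (@^~ j) e; rewrite /= jn en => /mulfI; apply.
  by have := nz 0%N isT; rewrite /= -en mulf_eq0 negb_or => /andP[].
have out m (y : nat -> R) : (m < j)%N -> collapse m y j = 0.
  by case: m => [|m] mj /=; [rewrite /vtx; case: j mj {nj}|case: ltngtP mj].
by rewrite !out.
Qed.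

End Geometry.

Section Extension.
Variable R : realType.
Local Notation pt := (pt R).
Local Notation I := (I01 R).

(** [wrap] maps the simplex of dimension [n] onto the boundary of the simplex
    of dimension [n + 1] and collapses its own boundary to the new vertex, the
    pole. The inner half, where [s = n.+1 * mincoord y] is at least 1/2, is
    stretched onto the face opposite to the pole; the outer half is spread
    over the cone from the boundary of that face to the pole. The factor
    [wrap_scale s] is 2 on the inner half and 2 s / (1 - s) on the outer one.
*)
Definition wrap_scale (s : R) : R := Num.min 1 (2 * s) / Num.max (1 - s) 2^-1.

Definition wrap n (y : pt) : pt := fun i =>
  let s := n.+1%:R * mincoord n y in
  if (i < n.+1)%N then wrap_scale s * (y i - mincoord n y) +
                       Num.max 0 ((2 * s - 1) / n.+1%:R)
  else if i == n.+1 then Num.max 0 (1 - 2 * s) else 0.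

Lemma wrap_cont n : continuous (wrap n).
Proof.
have sc : continuous (fun y : pt => n.+1%:R * mincoord n y).
  by apply: mulr_cont; [exact: cst_cont|exact: mincoord_cont].
have s2c : continuous (fun y : pt => 2 * (n.+1%:R * mincoord n y)).
  by apply: mulr_cont => //; exact: cst_cont.
apply: pt_continuous => i; rewrite /wrap.
case: (i < n.+1)%N; last case: (i == n.+1); last exact: cst_cont.
  apply: addr_cont.
    apply: mulr_cont; last first.
      by apply: subr_cont; [exact: pt_coord_cont|exact: mincoord_cont].
    apply: mulr_cont; first by apply: minr_cont => //; exact: cst_cont.
    apply: invr_cont => [|y].
      apply: maxr_cont; last exact: cst_cont.
      by apply: subr_cont => //; exact: cst_cont.
    by rewrite gt_eqF// lt_max invr_gt0 ltr0n orbT.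
  apply: maxr_cont; first exact: cst_cont.
  apply: mulr_cont; last exact: cst_cont.
  by apply: subr_cont => //; exact: cst_cont.
apply: maxr_cont; first exact: cst_cont.
by apply: subr_cont => //; exact: cst_cont.
Qed.

Lemma wrap_scale_low s : 0 <= s -> s <= 2^-1 -> wrap_scale s = 2 * s / (1 - s).
Proof. by move=> s0 s1; rewrite /wrap_scale min_r ?max_l//; lra. Qed.

Lemma wrap_scale_high s : 2^-1 <= s -> wrap_scale s = 2.
Proof. by move=> s1; rewrite /wrap_scale min_l ?max_r ?invrK ?mul1r//; lra. Qed.

Lemma wrap_low n y : 0 <= n.+1%:R * mincoord n y <= 2^-1 ->
  let s := n.+1%:R * mincoord n y in
  wrap n y = fun i =>
    if (i < n.+1)%N then 2 * s / (1 - s) * (y i - mincoord n y)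
    else if i == n.+1 then 1 - 2 * s else 0.
Proof.
move=> /andP[s0 s1] s; apply/funext => i; rewrite /wrap -/s.
rewrite wrap_scale_low// [X in _ + X]max_l ?addr0 ?[X in if i == _ then X else _]max_r//.
  by rewrite subr_ge0 /s; lra.
by rewrite pmulr_lle0 ?invr_gt0 ?ltr0n// /s; lra.
Qed.

Lemma wrap_high n y : 2^-1 <= n.+1%:R * mincoord n y ->
  wrap n y = fun i => if (i < n.+1)%N then 2 * y i - n.+1%:R^-1 else 0.
Proof.
move=> s1; apply/funext => i; rewrite /wrap wrap_scale_high//.
have n0 : n.+1%:R != 0 :> R by rewrite pnatr_eq0.
rewrite [X in _ + X]max_r; last first.
  by rewrite divr_ge0 ?ler0n//; lra.
rewrite [Num.max 0 (1 - _)]max_l; last by lra.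
case: ifP => _; last by case: ifP.
by move: (n.+1%:R : R) n0 => N N0; field.
Qed.

Lemma wrap_bdry n y : in_simplex n.+1 y -> in_boundary n.+2 (wrap n y).
Proof.
move=> sy; have [y0 yn y1] := sy; have /andP[s0 s1] := scaled_min_bounds sy.
have n0 : 0 < n.+1%:R :> R by rewrite ltr0n.
case: (leP (n.+1%:R * mincoord n y) 2^-1) => s2.
  have sl : 0 <= n.+1%:R * mincoord n y <= 2^-1 by rewrite s0 s2.
  rewrite (wrap_low sl); set s := n.+1%:R * mincoord n y in s0 s1 s2 *.
  have d0 : 0 < 1 - s by lra.
  split; last first.
    have [i i_n yi] := mincoord_attained n y.
    by exists i; [exact: ltnW|rewrite i_n yi subrr mulr0].
  split=> [i|i|].
  - case: ifP => i_n.
      apply: mulr_ge0; last by rewrite subr_ge0 mincoord_le.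
      by apply: divr_ge0; [rewrite mulr_ge0|exact: ltW].
    by case: ifP => // _; lra.
  - by case: ltngtP => //; lia.
  - rewrite big_ord_recr /= ltnn eqxx.
    under eq_bigr => i _ do rewrite ltn_ord.
    rewrite -mulr_sumr sumrB y1 sumr_const card_ord -[mincoord n y *+ _]mulr_natl.
    by rewrite -/s divfK ?gt_eqF// addrC subrK.
rewrite (wrap_high (ltW s2)).
split; last by exists n.+1 => //; rewrite ltnn.
split=> [i|i ni|].
- case: ifP => // i_n; rewrite subr_ge0.
  apply: (@le_trans _ _ (2 * mincoord n y)).
    by rewrite -(ler_pM2l n0) divff ?gt_eqF// mulrCA; lra.
  by rewrite ler_pM2l ?mincoord_le.
- by case: ltnP => //; lia.
- rewrite big_ord_recr /= ltnn addr0.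
  under eq_bigr => i _ do rewrite ltn_ord.
  rewrite sumrB -mulr_sumr y1 sumr_const card_ord -[_ *+ n.+1]mulr_natr mulVf ?gt_eqF//.
  by lra.
Qed.

Lemma wrap_pole n y : mincoord n y = 0 -> wrap n y = vtx R n.+1.
Proof.
move=> m0; have sl : 0 <= n.+1%:R * mincoord n y <= 2^-1.
  by rewrite m0 mulr0 lexx invr_ge0 ler0n.
rewrite (wrap_low sl) m0; apply/funext => i.
rewrite !mulr0 !mul0r subr0 /vtx.
by case: ltngtP => // i_n; rewrite ltn_eqF.
Qed.

Lemma wrap_inj n y y' : in_simplex n.+1 y -> in_simplex n.+1 y' -> wrap n y = wrap n y' ->
  y = y' \/ mincoord n y = 0 /\ mincoord n y' = 0.
Proof.
move=> sy sy' e; have [_ yn _] := sy; have [_ yn' _] := sy'.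
have /andP[s0 s1] := scaled_min_bounds sy.
have /andP[s0' s1'] := scaled_min_bounds sy'.
have n0 : n.+1%:R != 0 :> R by rewrite pnatr_eq0.
have ext : (forall i, (i < n.+1)%N -> y i = y' i) -> y = y'.
  by move=> h; apply/funext => i; case: (ltnP i n.+1) => [/h//|ni]; rewrite yn// yn'.
case: (ltP (n.+1%:R * mincoord n y) 2^-1) => s2; case: (ltP (n.+1%:R * mincoord n y') 2^-1) => s2'.
- have sl : 0 <= n.+1%:R * mincoord n y <= 2^-1 by rewrite s0 ltW.
  have sl' : 0 <= n.+1%:R * mincoord n y' <= 2^-1 by rewrite s0' ltW.
  move: e; rewrite (wrap_low sl) (wrap_low sl') => e.
  have ss : n.+1%:R * mincoord n y = n.+1%:R * mincoord n y'.
    by have := congr1 (@^~ n.+1) e; rewrite ltnn eqxx; lra.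
  have mm := mulfI n0 ss.
  case: (eqVneq (mincoord n y) 0) => [m0|m0]; first by right; rewrite -mm.
  left; apply: ext => i i_n; have := congr1 (@^~ i) e; rewrite i_n -mm.
  move/mulfI => h; apply: (addIr (- mincoord n y)); apply: h.
  apply: mulf_neq0; first by rewrite mulf_neq0 ?pnatr_eq0// mulf_neq0.
  by rewrite invr_neq0// gt_eqF// subr_gt0; apply: (lt_trans s2); lra.
- have sl : 0 <= n.+1%:R * mincoord n y <= 2^-1 by rewrite s0 ltW.
  move: e; rewrite (wrap_low sl) (wrap_high s2') => /(congr1 (@^~ n.+1)).
  by rewrite ltnn eqxx; lra.
- have sl' : 0 <= n.+1%:R * mincoord n y' <= 2^-1 by rewrite s0' ltW.
  move: e; rewrite (wrap_low sl') (wrap_high s2) => /(congr1 (@^~ n.+1)).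
  by rewrite ltnn eqxx; lra.
- move: e; rewrite (wrap_high s2) (wrap_high s2') => e.
  left; apply: ext => i i_n; have := congr1 (@^~ i) e.
  by rewrite /= i_n => /addIr; apply: mulfI; rewrite pnatr_eq0.
Qed.

Lemma wrap_surj n t : (0 < n)%N -> in_boundary n.+2 t ->
  exists2 y, in_simplex n.+1 y & wrap n y = t.
Proof.
move=> n_gt0 [[t0 tn t1] [i0 i0n ti0]].
have n0 : 0 < n.+1%:R :> R by rewrite ltr0n.
have sum_t : \sum_(i < n.+1) t i = 1 - t n.+1.
  apply: (addIr (t n.+1)); rewrite subrK -[RHS]t1 [in RHS]big_ord_recr.
  by congr (_ + _); apply: eq_bigr.
have tl1 : t n.+1 <= 1 by apply: (@in_simplex_le1 _ n.+2); split.
case: (eqVneq (t n.+1) 0) => [tl|tl].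
  (* the face opposite to the pole is covered by the inner half *)
  pose y : pt := fun i => if (i < n.+1)%N then (t i + n.+1%:R^-1) / 2 else 0.
  have y_ge i : (i < n.+1)%N -> n.+1%:R^-1 / 2 <= y i.
    by move=> i_n; rewrite /y i_n ler_pM2r ?invr_gt0 ?ltr0n// lerDr.
  exists y.
    split=> [i|i ni|].
    - case: (ltnP i n.+1) => i_n; last by rewrite /y ltnNge i_n.
      by apply: le_trans (y_ge _ i_n); rewrite divr_ge0// invr_ge0 ltW.
    - by rewrite /y ltnNge ni.
    - rewrite /y; under eq_bigr => i _ do rewrite ltn_ord.
      rewrite -mulr_suml big_split /= sum_t tl sumr_const card_ord -[_ *+ n.+1]mulr_natr.
      by rewrite mulVf ?gt_eqF// subr0 divff.
  have ms : 2^-1 <= n.+1%:R * mincoord n y.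
    rewrite mulrC -ler_pdivrMr//; apply: mincoord_ge => i /y_ge.
    by rewrite mulrC.
  rewrite (wrap_high ms); apply/funext => i; rewrite /y.
  case: ltnP => [_|].
    by move: (n.+1%:R : R) n0 => N N0; field; rewrite gt_eqF.
  by rewrite leq_eqVlt => /orP[/eqP <-|/tn].
case: (eqVneq (t n.+1) 1) => [te|te].
  exists (vtx R 0); first exact: in_simplex_vtx.
  rewrite wrap_pole; last first.
    by apply: (@mincoordE _ _ _ _ 1%N) => // j _; rewrite ler0n.
  apply/funext => i; rewrite /vtx; case: eqP => [->//|ne].
  case: (ltnP i n.+1) => [i_n|ni]; last by rewrite tn//; lia.
  have : \sum_(j < n.+1) t j == 0 by rewrite sum_t te subrr.
  rewrite psumr_eq0 => [/allP /(_ (Ordinal i_n))|? _]; last exact: t0.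
  by rewrite mem_index_enum => /(_ isT) /eqP /= ->.
have tlp : 0 < t n.+1 by rewrite lt_neqAle eq_sym tl t0.
have tlm : t n.+1 < 1 by rewrite lt_neqAle te.
have i0n' : (i0 < n.+1)%N.
  by move: i0n tl; rewrite ltnS leq_eqVlt => /orP[/eqP e|//]; rewrite -e ti0 eqxx.
(* the last coordinate 1 - 2 s determines s; then solve for the others *)
pose s := (1 - t n.+1) / 2.
have s0 : 0 < s by rewrite /s; lra.
pose y : pt := fun i => if (i < n.+1)%N then (1 - s) / (2 * s) * t i + s / n.+1%:R else 0.
have k0 : 0 <= (1 - s) / (2 * s) by rewrite divr_ge0 /s; lra.
have my : mincoord n y = s / n.+1%:R.
  apply: (@mincoordE _ _ _ _ i0) => //; first by rewrite /y i0n' ti0 mulr0 add0r.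
  by move=> j jn; rewrite /y jn lerDr mulr_ge0.
have nm : n.+1%:R * mincoord n y = s by rewrite my mulrC divfK ?gt_eqF.
exists y.
  split=> [i|i ni|].
  - rewrite /y; case: ifP => // _; apply: addr_ge0; first exact: mulr_ge0.
    by apply: divr_ge0; exact: ltW.
  - by rewrite /y ltnNge ni.
  - rewrite /y; under eq_bigr => i _ do rewrite ltn_ord.
    rewrite big_split /= -mulr_sumr sum_t sumr_const card_ord -[_ *+ n.+1]mulr_natr.
    have -> : 1 - t n.+1 = 2 * s by rewrite /s; lra.
    by rewrite !divfK ?subrK ?gt_eqF// mulr_gt0.
have sl : 0 <= n.+1%:R * mincoord n y <= 2^-1.
  by rewrite nm ltW//= /s; lra.
rewrite (wrap_low sl) nm my; apply/funext => i; rewrite /y.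
case: ltngtP => [i_n|ni|->]; last by rewrite /s; lra.
  rewrite addrK mulrA; have -> : 2 * s / (1 - s) * ((1 - s) / (2 * s)) = 1.
    by field; rewrite !gt_eqF ?s0// /s; lra.
  by rewrite mul1r.
by rewrite tn.
Qed.

(** The straight line from [y] to the barycenter. From a boundary point, the
    scaled least coordinate is the time ([mincoord_cone]), so a point other
    than the barycenter determines [y] and [s]. *)
Definition cone_pt n (y : pt) (s : R) : pt :=
  fun i => (1 - s) * y i + s * (if (i < n.+1)%N then n.+1%:R^-1 else 0).

Lemma cone_cont (T : topologicalType) n (y : T -> pt) (s : T -> R) :
  continuous y -> continuous s -> continuous (fun x => cone_pt n (y x) (s x)).
Proof.
move=> yc sc; apply: pt_continuous => i; apply: addr_cont; apply: mulr_cont => //.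
- by apply: subr_cont => //; exact: cst_cont.
- exact: (comp_cont yc (@pt_coord_cont R i)).
- exact: cst_cont.
Qed.

Lemma mincoord_cone n y s : in_boundary n.+1 y -> 0 <= s <= 1 ->
  n.+1%:R * mincoord n (cone_pt n y s) = s.
Proof.
move=> [[y0 yn y1] [i i_n yi]] /andP[s0 s1].
rewrite (@mincoordE _ _ _ (s / n.+1%:R) i)//.
- by rewrite mulrC divfK// pnatr_eq0.
- by rewrite /cone_pt i_n yi mulr0 add0r.
- by move=> j jn; rewrite /cone_pt jn lerDr mulr_ge0// subr_ge0.
Qed.

Lemma cone_surj n t : (0 < n)%N -> in_simplex n.+1 t ->
  exists y s, [/\ in_boundary n.+1 y, 0 <= s <= 1 & cone_pt n y s = t].
Proof.
move=> n_gt0 st; have [t0 tn t1] := st; have sb := scaled_min_bounds st.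
pose s := n.+1%:R * mincoord n t; have /andP[s0 s1] := sb; rewrite -/s in s0 s1.
have n0 : n.+1%:R != 0 :> R by rewrite pnatr_eq0.
have me : mincoord n t = s / n.+1%:R by rewrite /s mulrC mulKf.
case: (eqVneq s 1) => [se|se].
  exists (vtx R 0), 1; rewrite lexx ler01; split=> //.
    by split; [exact: in_simplex_vtx|exists 1%N].
  apply/funext => i; rewrite /cone_pt subrr mul0r add0r mul1r.
  case: ltnP => i_n; last by rewrite tn.
  have h : \sum_(j < n.+1) (t j - n.+1%:R^-1) == 0.
    by rewrite sumrB t1 sumr_const card_ord -[_ *+ n.+1]mulr_natr mulVf// subrr.
  move: h; rewrite psumr_eq0 => [/allP /(_ (Ordinal i_n))|j _].
    by rewrite mem_index_enum subr_eq0 => /(_ isT) /eqP /= ->.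
  by rewrite subr_ge0; move: me; rewrite se mul1r => <-; exact: mincoord_le.
have d0 : 0 < 1 - s by rewrite subr_gt0 lt_neqAle se.
pose y : pt := fun i => if (i < n.+1)%N then (t i - s / n.+1%:R) / (1 - s) else 0.
exists y, s; rewrite sb; split=> //.
  split.
    split=> [i|i ni|].
    - rewrite /y; case: ifP => // i_n; apply: divr_ge0; last exact: ltW.
      by rewrite subr_ge0 -me mincoord_le.
    - by rewrite /y ltnNge ni.
    - rewrite /y; under eq_bigr => i _ do rewrite ltn_ord.
      rewrite -mulr_suml sumrB t1 sumr_const card_ord -[_ *+ n.+1]mulr_natr divfK//.
      by rewrite divff// gt_eqF.
  have [i i_n ti] := mincoord_attained n t.
  by exists i => //; rewrite /y i_n ti me subrr mul0r.
apply/funext => i; rewrite /cone_pt /y; case: ltnP => i_n; last by rewrite !mulr0 addr0 tn.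
by rewrite mulrC divfK ?gt_eqF// subrK.
Qed.

End Extension.

Section Fill.
Variable R : realType.
Local Notation pt := (pt R).
Local Notation I := (I01 R).

(** Coordinates out of range read as zero. *)
Definition cube_coord n (v : 'rV[R]_n) : nat -> R :=
  fun i => if insub i is Some j then v 0 j else 0.

Lemma cube_coord_cont n i : continuous (fun v : 'rV[R]_n => cube_coord v i).
Proof.
rewrite /cube_coord; case: (insub i) => [j|]; last exact: cst_cont.
by move=> v; exact: coord_continuous.
Qed.

Lemma cube_coordE n (v : 'rV[R]_n) (j : 'I_n) : cube_coord v j = v 0 j.
Proof. by rewrite /cube_coord valK. Qed.

Lemma cube_of_coord n x : in_cube n x ->
  exists v : set_type (cube R n), forall i, (i < n)%N ->
    cube_coord (set_val v) i = x i.
Proof.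
move=> xc; have rowx : cube R n (\row_i x i) by move=> i; rewrite mxE; exact: xc.
exists (exist _ (\row_i x i : 'rV[R]_n) (mem_set rowx)) => i i_n.
by rewrite set_valE /= -[i]/(val (Ordinal i_n)) cube_coordE mxE.
Qed.

Lemma cube_compact n : compact (cube R n).
Proof.
have -> : cube R n = [set v | forall i, `[0 : R, 1]%classic (v ord0 i)].
  by apply/seteqP; split=> v /= vc i; have := vc i; rewrite in_itv.
by apply: (@rV_compact R n (fun=> `[0 : R, 1]%classic)) => i; exact: segment_compact.
Qed.

(** Let [bd] be a map on the boundary of the simplex of dimension [n + 1]. Its
    composite with [wrap] and [collapse] is a map on the cube of dimension [n]
    that is constant on the boundary, so it has a null homotopy. The product
    of the cube with the interval maps onto the simplex by coning off to the
    barycenter, and the null homotopy is constant on the fibres of this map: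
    it descends to the extension sought. Continuity of [bd] on the boundary is
    expressed by its composites with maps into the boundary. *)
Lemma extend_simplex n (X : topologicalType) (bd : pt -> X) :
  (1 < n)%N -> (forall x : X, pi_trivial R n x) ->
  (forall (S : topologicalType) (c : S -> pt), continuous c ->
    (forall s, in_boundary n.+2 (c s)) -> continuous (fun s => bd (c s))) ->
  exists2 F : pt -> X, continuous F & forall t, in_boundary n.+2 t -> F t = bd t.
Proof.
move=> n1 piX bdc; pose V := set_type (cube R n).
pose y (v : V) : pt := collapse n (cube_coord (set_val v)).
have v_cube (v : V) : in_cube n (cube_coord (set_val v)).
  by move=> i i_n; have := set_valP v (Ordinal i_n); rewrite -cube_coordE.
have ys v : in_simplex n.+1 (y v) by apply: collapse_simp; exact: v_cube.
have yc : continuous y.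
  apply: (@collapse_cont R V n (fun v : V => cube_coord (set_val v))) => i.
  exact: (comp_cont (@set_val_cont _ _) (@cube_coord_cont n i)).
have byc : continuous (fun v => wrap n (y v)) := comp_cont yc (@wrap_cont R n).
have bys v : in_boundary n.+2 (wrap n (y v)) by exact: wrap_bdry.
have y_bdry (v : V) : cube_boundary v -> mincoord n (y v) = 0.
  move=> [i vi]; have [|j jn yj] := @collapse_bdry R n (cube_coord (set_val v)) i (ltn_ord i).
    by rewrite cube_coordE.
  by apply: (mincoordE jn yj) => l _; have [h _ _] := ys v; exact: h.
have y_zero (v : V) j : (j < n.+1)%N -> y v j = 0 -> cube_boundary v.
  move=> jn yj; have [i i_n vi] := collapse_zero jn yj.
  by exists (Ordinal i_n); rewrite -!cube_coordE; exact: vi.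
pose f v := bd (wrap n (y v)).
have f_pole v : mincoord n (y v) = 0 -> f v = bd (vtx R n.+1).
  by move=> m0; rewrite /f wrap_pole.
have [H [Hc H0 H1 Hb]] := piX (bd (vtx R n.+1)) f (bdc _ _ byc bys)
  (fun v vb => f_pole v (y_bdry v vb)).
pose q (c : V * I) := cone_pt n.+1 (wrap n (y c.1)) (set_val c.2).
have qc : continuous q.
  apply: cone_cont; first exact: comp_cont (@fst_cont _ _) byc.
  exact: comp_cont (@snd_cont _ _) (@set_val_cont _ _).
have sI (s : I) : 0 <= (set_val s : R) <= 1 by rewrite I01_ge0 I01_le1.
have [] := @descend R _ X q (@retraction R n.+1) H _ qc (@retraction_cont R n.+1) Hc.
- rewrite -setXTT; apply: compact_setX; last exact: I01_compact.
  exact/compact_set_type/cube_compact.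
- move=> t; have [z [s [bz s01 <-]]] := cone_surj (ltn0Sn n) (retraction_simp n.+1 t).
  have [u su <-] := wrap_surj (ltnW n1) bz.
  have [x xc <-] := collapse_surj su.
  have [v vx] := cube_of_coord xc.
  exists (v, clip s); rewrite /q /= clip_val//; congr cone_pt.
  by congr wrap; apply: collapse_agree.
- move=> [v s] [v' s'] /= e.
  have ss : s = s'.
    have h := mincoord_cone (bys v) (sI s).
    have h' := mincoord_cone (bys v') (sI s').
    by apply/val_inj; rewrite -[cone_pt _ _ _]/(q (v, s)) e in h; exact: (etrans (esym h) h').
  subst s'; case: (eqVneq (set_val s : R) 1) => [s1|s1].
    have -> : s = clip 1 by rewrite -s1 val_clip.
    by rewrite !H1.
  have {}e : wrap n (y v) = wrap n (y v').
    apply/funext => i; have := congr1 (@^~ i) e; rewrite /q /cone_pt /= => /addIr.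
    by apply: mulfI; rewrite subr_eq0 eq_sym.
  have Hb2 w w' : cube_boundary w -> cube_boundary w' -> f w = f w' ->
    H (w, s) = H (w', s) by move=> wb wb' ff; rewrite !Hb.
  have [yy|[m0 m0']] := wrap_inj (ys v) (ys v') e; last first.
    have [j jn yj] := mincoord_attained n (y v).
    have [j' jn' yj'] := mincoord_attained n (y v').
    apply: Hb2; last by rewrite !f_pole.
      by apply: y_zero jn _; rewrite yj.
    by apply: y_zero jn' _; rewrite yj'.
  case: (pselect (exists2 j, (j < n.+1)%N & y v j = 0)) => [[j jn yj]|nz].
    apply: Hb2; [exact: y_zero jn yj| |by rewrite /f yy].
    by apply: (@y_zero _ j); rewrite -?yy.
  suff -> : v = v' by [].
  apply/val_inj/rowP => j; rewrite -!cube_coordE.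
  apply: collapse_inj yy _ (ltn_ord j) => l ln.
  by apply/eqP => yl; apply: nz; exists l.
move=> F Fc FE; exists F => // t bt.
have [u su eu] := wrap_surj (ltnW n1) bt.
have [x xc ex] := collapse_surj su.
have [v vx] := cube_of_coord xc.
have yv : y v = u by rewrite -ex; apply: collapse_agree.
have qv : q (v, clip 0) = t.
  rewrite /q /= yv eu; apply/funext => i; rewrite /cone_pt clip_val ?lexx ?ler01//.
  by rewrite subr0 mul1r mul0r addr0.
by rewrite -qv FE qv ?H0 ?retraction_id ?/f ?yv ?eu//; case: bt.
Qed.

Definition tent (t : R) : R := Num.min (2 * t) (2 - 2 * t).

(** The square maps onto the triangle: at time 0 along the broken path through
    the middle vertex, at time 1 along the straight edge, and linearly in
    between. Only the two vertical sides are collapsed, and a homotopy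
    relative to the ends is constant on them. *)
Lemma extend_triangle (X : topologicalType) (p q r : I -> X) :
  homotopic_rel R [set clip 0; clip 1] (concat p q) r ->
  p (clip 1) = q (clip 0) ->
  exists2 F : pt -> X, continuous F & forall t, in_simplex 3 t ->
    [/\ t 0%N = 0 -> F t = q (clip (t 2%N)),
        t 1%N = 0 -> F t = r (clip (t 2%N)) &
        t 2%N = 0 -> F t = p (clip (t 1%N))].
Proof.
move=> [H [Hc H0 H1 Hb]] pq.
(* barycentric coordinate of the middle vertex *)
pose mid (c : I * I) : R := (1 - set_val c.2) * tent (set_val c.1).
pose Q (c : I * I) : pt := fun i =>
  match i with
  | 0 => (2 - mid c - 2 * set_val c.1) / 2
  | 1 => mid c
  | 2 => (2 * set_val c.1 - mid c) / 2
  | _ => 0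
  end.
have v1c : continuous (fun c : I * I => set_val c.1 : R).
  exact: comp_cont (@fst_cont _ _) (@set_val_cont _ _).
have v2c : continuous (fun c : I * I => set_val c.2 : R).
  exact: comp_cont (@snd_cont _ _) (@set_val_cont _ _).
have dv1c : continuous (fun c : I * I => 2 * set_val c.1 : R).
  by apply: mulr_cont => //; exact: cst_cont.
have midc : continuous mid.
  apply: mulr_cont; first by apply: subr_cont => //; exact: cst_cont.
  apply: minr_cont => //; apply: subr_cont => //; exact: cst_cont.
have Qc : continuous Q.
  apply: pt_continuous => -[|[|[|i]]] /=; [| |  |exact: cst_cont].
  - apply: mulr_cont; last exact: cst_cont.
    apply: subr_cont => //; apply: subr_cont => //; exact: cst_cont.
  - exact: midc.
  - apply: mulr_cont; last exact: cst_cont.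
    exact: subr_cont.
have hat_ge0 (s : I) : 0 <= tent (set_val s).
  by rewrite /tent le_min; have := I01_ge0 s; have := I01_le1 s; lra.
have mid_bounds c : 0 <= mid c <= tent (set_val c.1).
  rewrite mulr_ge0 ?subr_ge0 ?I01_le1//= ler_piMl//.
  by have := I01_ge0 c.2; lra.
have Qs c : in_simplex 3 (Q c).
  have /andP[m0 m1] := mid_bounds c.
  have h1 : mid c <= 2 * set_val c.1.
    by apply: le_trans m1 _; rewrite ge_min lexx.
  have h2 : mid c <= 2 - 2 * set_val c.1.
    by apply: le_trans m1 _; rewrite ge_min lexx orbT.
  split=> [[|[|[|i]]]|[|[|[|i]]]|] //=.
  - by apply: divr_ge0 => //; rewrite subr_ge0; lra.
  - by apply: divr_ge0 => //; rewrite subr_ge0; lra.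
  - by rewrite !big_ord_recl big_ord0 /=; lra.
have simp3 (t : pt) : in_simplex 3 t -> [/\ 0 <= t 0%N, 0 <= t 1%N, 0 <= t 2%N,
    t 0%N + t 1%N + t 2%N = 1 & forall i, t i.+3 = 0].
  move=> [t0 tn t1]; split=> // [|i]; last exact: tn.
  by rewrite -[RHS]t1 !big_ord_recl big_ord0 /= addr0 addrA.
have QE t (c : I * I) : in_simplex 3 t -> set_val c.1 = (1 + t 2%N - t 0%N) / 2 :> R ->
    mid c = t 1%N -> Q c = t.
  move=> /simp3 [? ? ? ? t3] c1 m; apply/funext => -[|[|[|i]]] /=; rewrite ?c1 ?m//.
  - by lra.
  - by lra.
have [] := @descend R _ X Q (@retraction R 2) H _ Qc (@retraction_cont R 2) Hc.
- by rewrite -setXTT; apply: compact_setX; exact: I01_compact.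
- move=> t; have := retraction_simp 2 t; move: (retraction 2 t) => {}t st.
  have [t0 t1 t2 t012 _] := simp3 t st.
  pose h := tent ((1 + t 2%N - t 0%N) / 2).
  have ht : t 1%N <= h by rewrite /h /tent le_min; lra.
  have cv : set_val (clip ((1 + t 2%N - t 0%N) / 2)) = (1 + t 2%N - t 0%N) / 2.
    by rewrite clip_val//; lra.
  case: (eqVneq h 0) => [h0|h0].
    exists (clip ((1 + t 2%N - t 0%N) / 2), clip 0); apply: QE => //=.
    by rewrite /mid /= cv -/h h0 mulr0; lra.
  have hp : 0 < h by rewrite lt_neqAle eq_sym h0 (le_trans t1).
  exists (clip ((1 + t 2%N - t 0%N) / 2), clip (1 - t 1%N / h)); apply: QE => //=.
  rewrite /mid /= cv -/h clip_val; first by rewrite subKr divfK.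
  have : 0 <= t 1%N / h <= 1 by rewrite divr_ge0 ?(ltW hp)//= ler_pdivrMr// mul1r.
  by lra.
- move=> [a b] [a' b'] e.
  have e0 := congr1 (@^~ 0%N) e; have e1 := congr1 (@^~ 1%N) e.
  have e2 := congr1 (@^~ 2%N) e; rewrite /= in e0 e1 e2.
  have aa : a = a'.
    by apply/val_inj; rewrite -[LHS]/(set_val a) -[RHS]/(set_val a'); lra.
  subst a'; rewrite /mid /= in e1.
  case: (eqVneq (tent (set_val a)) 0) => [h0|h0]; last first.
    have /(mulIf h0) bb := e1; have -> // : b = b'.
    by apply/val_inj; rewrite -[LHS]/(set_val b) -[RHS]/(set_val b'); lra.
  have ab : [set clip 0; clip 1] a.
    have : (set_val a = 0 :> R) \/ (set_val a = 1 :> R).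
      move: h0; rewrite /tent; case: (leP (2 * (set_val a : R))) => _ a0.
        by left; lra.
      by right; lra.
    by case=> a01; [left|right]; rewrite /= -[LHS]val_clip a01.
  by rewrite !Hb.
move=> F Fc FE; exists F => // t st; have [t0 t1 t2 t012 _] := simp3 t st.
have FQ c : Q c = t -> F t = H c.
  by move=> Qt; rewrite -Qt FE// retraction_id//; exact: Qs.
have v0 : set_val (clip 0) = 0 :> R by rewrite clip_val// lexx ler01.
have v1 : set_val (clip 1) = 1 :> R by rewrite clip_val// lexx ler01.
split=> tz.
- have cv : set_val (clip ((1 + t 2%N) / 2)) = (1 + t 2%N) / 2.
    by rewrite clip_val//; lra.
  have ct : Q (clip ((1 + t 2%N) / 2), clip 0) = t.
    apply: QE => //=; first by rewrite cv; lra.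
    by rewrite /mid /= cv v0 subr0 mul1r /tent min_r; lra.
  rewrite (FQ _ ct) H0 /concat cv; case: ifPn => h.
    have -> : t 2%N = 0 by lra.
    by have -> : 2 * ((1 + 0) / 2) = 1 :> R by lra.
  by congr (q (clip _)); lra.
- have cv : set_val (clip (t 2%N)) = t 2%N by rewrite clip_val//; lra.
  have ct : Q (clip (t 2%N), clip 1) = t.
    apply: QE => //=; first by rewrite cv; lra.
    by rewrite /mid /= v1 subrr mul0r tz.
  by rewrite (FQ _ ct) H1.
- have cv : set_val (clip (t 1%N / 2)) = t 1%N / 2 by rewrite clip_val//; lra.
  have ct : Q (clip (t 1%N / 2), clip 0) = t.
    apply: QE => //=; first by rewrite cv; lra.
    by rewrite /mid /= cv v0 subr0 mul1r /tent min_l; lra.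
  have h : t 1%N / 2 <= 2^-1 by lra.
  rewrite (FQ _ ct) H0 /concat cv h.
  by congr (p (clip _)); lra.
Qed.

End Fill.

(** * Singular simplices indexed by tuples of the fundamental group *)

Lemma del_del (T : Type) z j (g : seq T) : (z <= j)%N ->
  del j (del z g) = del z (del j.+1 g).
Proof.
elim: g z j => [|x g IH] [|z] [|j] zj; rewrite ?del0 ?delS ?del0//.
by rewrite ?delS IH.
Qed.

Section Faces.
Variable R : realType.
Local Notation pt := (pt R).

(** Inverse to [insert0 j] on the face where the [j]-th coordinate vanishes. *)
Definition drop_coord (j : nat) (t : pt) : pt := fun i => t (bump j i).

Lemma insert0_bump j (t : pt) i : insert0 j t (bump j i) = t i.
Proof.
rewrite /insert0 /bump; case: (leqP j i) => ji; last by rewrite add0n ji.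
rewrite add1n ltnNge (leq_trans ji (leqnSn i))/=.
by rewrite gtn_eqF.
Qed.

Lemma insert0_self j (t : pt) : insert0 j t j = 0.
Proof. by rewrite /insert0 ltnn eqxx. Qed.

Lemma drop_insert0 j (t : pt) : drop_coord j (insert0 j t) = t.
Proof. by apply/funext => i; rewrite /drop_coord insert0_bump. Qed.

Lemma insert0_drop j (t : pt) : t j = 0 -> insert0 j (drop_coord j t) = t.
Proof.
move=> tj; apply/funext => i; rewrite /insert0 /drop_coord /bump.
case: (ltngtP i j) => ij //; last by rewrite ij tj.
have i0 : (0 < i)%N by exact: leq_ltn_trans ij.
by rewrite -ltnS prednK// ij add1n prednK.
Qed.

Lemma drop_drop z j (t : pt) : (z <= j)%N ->
  drop_coord j (drop_coord z t) = drop_coord z (drop_coord j.+1 t).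
Proof.
move=> zj; apply/funext => i; rewrite /drop_coord; congr t; rewrite /bump.
by do ![case: leqP => ?]; lia.
Qed.

Lemma in_simplex_insert0 n j (t : pt) : (j < n.+1)%N ->
  in_simplex n.+1 (insert0 j t) <-> in_simplex n t.
Proof.
move=> jn; have sumE : \sum_(i < n.+1) insert0 j t i = \sum_(i < n) t i.
  rewrite (bigD1_ord (Ordinal jn))//= insert0_self add0r.
  by apply: eq_bigr => i _; rewrite insert0_bump.
split=> -[t0 tn t1]; split.
- by move=> i; rewrite -(insert0_bump j).
- by move=> i ni; rewrite -(insert0_bump j) tn// /bump; case: (leqP j i); lia.
- by rewrite -sumE.
- by move=> i; rewrite /insert0; case: ifP => // _; case: ifP.
- move=> i ni; have ji : (j < i)%N by exact: leq_trans ni.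
  by rewrite /insert0 ltnNge (ltnW ji)/= gtn_eqF// tn//; case: i ni {ji}.
- by rewrite sumE.
Qed.

Lemma in_simplex_drop n j (t : pt) : (j < n.+1)%N -> t j = 0 -> in_simplex n.+1 t ->
  in_simplex n (drop_coord j t).
Proof. by move=> jn tj st; apply/(in_simplex_insert0 _ jn); rewrite insert0_drop. Qed.

Lemma drop_coord_cont j : continuous (drop_coord j).
Proof. by apply: pt_continuous => i; exact: pt_coord_cont. Qed.

(** The first face that contains a given boundary point; [n] if there is none.
*)
Definition zero_coord n (t : pt) : nat := find (fun i => t i == 0) (iota 0 n).

Lemma zero_coordP n t : in_boundary n t ->
  (zero_coord n t < n)%N /\ t (zero_coord n t) = 0.
Proof.
move=> [_ [i i_n ti]]; have h : has (fun i => t i == 0) (iota 0 n).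
  by apply/hasP; exists i; rewrite ?mem_iota ?add0n ?ti.
have zn : (zero_coord n t < n)%N by rewrite /zero_coord -[X in (_ < X)%N](size_iota 0) -has_find.
by split=> //; have := nth_find 0%N h; rewrite nth_iota// => /eqP.
Qed.

Definition seg (s t : pt) (a : R) : pt := fun i => (1 - a) * s i + a * t i.

Lemma seg_cont (T : topologicalType) (s t : T -> pt) (a : T -> R) :
  continuous s -> continuous t -> continuous a ->
  continuous (fun x => seg (s x) (t x) (a x)).
Proof.
move=> sc tc ac; apply: pt_continuous => i; apply: addr_cont; apply: mulr_cont => //.
- by apply: subr_cont => //; exact: cst_cont.
- exact: (comp_cont sc (@pt_coord_cont R i)).
- exact: (comp_cont tc (@pt_coord_cont R i)).
Qed.

Lemma seg0 s t : seg s t 0 = s.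
Proof. by apply/funext => i; rewrite /seg subr0 mul1r mul0r addr0. Qed.

Lemma seg1 s t : seg s t 1 = t.
Proof. by apply/funext => i; rewrite /seg subrr mul1r mul0r add0r. Qed.

Lemma segss s a : seg s s a = s.
Proof. by apply/funext => i; rewrite /seg mulrBl mul1r subrK. Qed.

Lemma in_simplex_seg n s t a : in_simplex n s -> in_simplex n t ->
  0 <= a <= 1 -> in_simplex n (seg s t a).
Proof.
move=> [s0 sn s1] [t0 tn t1] /andP[a0 a1]; split=> [i|i ni|]; rewrite /seg.
- by rewrite addr_ge0// mulr_ge0// subr_ge0.
- by rewrite sn// tn// !mulr0 addr0.
- by rewrite big_split /= -!mulr_sumr s1 t1 !mulr1 subrK.
Qed.

Lemma insert0_seg j s t a : insert0 j (seg s t a) = seg (insert0 j s) (insert0 j t) a.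
Proof.
apply/funext => i; rewrite /seg /insert0; case: ifP => // _; case: ifP => // _.
by rewrite !mulr0 addr0.
Qed.

End Faces.

Section Simplices.
Variables (R : realType) (X : topologicalType) (x0 : X) (G : groupType).
Local Notation pt := (pt R).
Local Notation I := (I01 R).
Variables (phi : (I -> X) -> G) (l : G -> I -> X).
Hypothesis phi_eq : forall p q, loop x0 p -> loop x0 q ->
  phi p = phi q <-> homotopic_rel R [set clip 0; clip 1] p q.
Hypothesis phi_concat : forall p q, loop x0 p -> loop x0 q ->
  phi (concat p q) = (phi p * phi q)%g.
Hypothesis l_loop : forall g, loop x0 (l g).
Hypothesis phi_l : forall g, phi (l g) = g.
Hypothesis pi_triv : forall (x : X) n, (2 <= n)%N -> pi_trivial R n x.

Lemma concat0 (p q : I -> X) : concat p q (clip 0) = p (clip 0).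
Proof. by rewrite /concat clip_val ?lexx ?ler01// invr_ge0 ler0n mulr0. Qed.

Lemma concat1 (p q : I -> X) : concat p q (clip 1) = q (clip 1).
Proof.
rewrite /concat clip_val ?lexx ?ler01// ifF; last by apply/negbTE; rewrite -ltNge; lra.
by rewrite mulr1 -[2]/(1 + 1) addrK.
Qed.

Lemma loop_concat (p q : I -> X) : loop x0 p -> loop x0 q -> loop x0 (concat p q).
Proof.
move=> [pc p0 p1] [qc q0 q1]; split; rewrite ?concat0 ?concat1//.
by apply: concat_path_cont; rewrite ?p1.
Qed.

(** An extension chosen as a function of the boundary map only; this makes the
    simplices invariant under left multiplication ([bar_simplex_mul]). *)
Definition filler n (bd : pt -> X) : pt -> X :=
  xget (cst x0) [set F | continuous F /\ forall t, in_boundary n t -> F t = bd t].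

(** The default [head 1 g] of [nth] keeps the definition invariant also for
    tuples that are too short. *)
Fixpoint bar_simplex_rec n (g : seq G) : pt -> X :=
  match n with
  | 0 => cst x0
  | n'.+1 => match n' with
    | 0 => fun t => l ((nth (head 1 g) g 0)^-1 * nth (head 1 g) g 1)%g (clip (t 1%N))
    | _ => filler n.+1 (fun t =>
        bar_simplex_rec n' (del (zero_coord n.+1 t) g) (drop_coord (zero_coord n.+1 t) t))
    end
  end.

Definition bar_simplex (g : seq G) : pt -> X := bar_simplex_rec (size g).-1 g.

Lemma bar_simplex_mul h g : bar_simplex (map (fun x => (h * x)%g) g) = bar_simplex g.
Proof.
rewrite /bar_simplex size_map; move: (size g).-1 => n; elim: n g => // -[|n] IH g.
  case: g => // a g /=; have nthM i : nth (h * a)%g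
      ((h * a)%g :: map (fun x => (h * x)%g) g) i = (h * nth a (a :: g) i)%g.
    case: i => //= i; case: (ltnP i (size g)) => ig; first by rewrite (nth_map a).
    by rewrite !nth_default ?size_map.
  apply/funext => t; have := nthM 1%N; rewrite /= => ->.
  by rewrite invgM mulgA mulgVK.
rewrite [LHS]/= [RHS]/=; congr filler; apply/funext => t.
by rewrite -map_del -/(bar_simplex_rec n.+1 _) IH.
Qed.

(** Continuity and compatibility with faces go together in one induction: the
    boundary map is well defined because simplices of one dimension less agree
    on common faces, it is continuous because it is pasted from finitely many
    closed faces, and so it can be extended. *)
Lemma bar_simplex_properties n g : size g = n.+1 ->
  continuous (bar_simplex g) /\
  forall j t, (0 < n)%N -> (j < n.+1)%N -> in_simplex n.+1 t -> t j = 0 ->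
    bar_simplex g t = bar_simplex (del j g) (drop_coord j t).
Proof.
elim: n g => [|[|n] IH] g sg.
- by rewrite /bar_simplex sg /=; split => //; exact: cst_cont.
- rewrite /bar_simplex sg /=; split.
    have [lc _ _] := l_loop ((nth (head 1 g) g 0)^-1 * nth (head 1 g) g 1)%g.
    apply: (comp_cont _ lc); exact: (comp_cont (@pt_coord_cont R 1%N) (@clip_cont R)).
  move=> j t _ jn [t0 tn]; rewrite !big_ord_recl big_ord0 addr0 /= => t1 tj.
  rewrite size_del ?sg//= /cst.
  have [_ l0 l1] := l_loop ((nth (head 1 g) g 0)^-1 * nth (head 1 g) g 1)%g.
  case: j jn tj => [|[|//]] _ tj; last by rewrite tj.
  by have -> : t 1%N = 1 by rewrite -t1 tj add0r.
pose bd (t : pt) := bar_simplex_rec n.+1 (del (zero_coord n.+3 t) g)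
  (drop_coord (zero_coord n.+3 t) t).
have sigE : bar_simplex g = filler n.+3 bd by rewrite /bar_simplex sg.
have compat z j t : (z < j)%N -> (j < n.+3)%N -> in_simplex n.+3 t ->
    t z = 0 -> t j = 0 ->
    bar_simplex (del z g) (drop_coord z t) = bar_simplex (del j g) (drop_coord j t).
  move=> zj jn st tz tj; case: j zj jn tj => // j zj jn tj.
  have zn : (z < n.+3)%N by lia.
  have [_ fz] := IH (del z g) ltac:(by rewrite size_del sg).
  have [_ fj] := IH (del j.+1 g) ltac:(by rewrite size_del sg).
  have zj' : (z <= j)%N by [].
  have tzj : drop_coord z t j = 0 by rewrite /drop_coord /bump zj'.
  have tjz : drop_coord j.+1 t z = 0 by rewrite /drop_coord /bump ltnNge zj'.
  have -> := fz j (drop_coord z t) isT jn (in_simplex_drop zn tz st) tzj.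
  have zn' : (z < n.+2)%N := leq_trans zj (jn : (j.+1 <= n.+2)%N).
  have -> := fj z (drop_coord j.+1 t) isT zn' (in_simplex_drop jn tj st) tjz.
  by rewrite (del_del _ zj') (drop_drop _ zj').
have bdE t j : (j < n.+3)%N -> in_simplex n.+3 t -> t j = 0 ->
    bd t = bar_simplex (del j g) (drop_coord j t).
  move=> jn st tj; have bt : in_boundary n.+3 t by split => //; exists j.
  have [zn tz] := zero_coordP bt; rewrite /bd.
  have -> u : bar_simplex_rec n.+1 (del (zero_coord n.+3 t) g) u =
      bar_simplex (del (zero_coord n.+3 t) g) u.
    by rewrite /bar_simplex size_del ?sg.
  case: (ltngtP (zero_coord n.+3 t) j) => [zj|jz|-> //]; first exact: compat.
  by apply/esym/compat.
have bdc (S : topologicalType) (c : S -> pt) : continuous c ->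
    (forall s, in_boundary n.+3 (c s)) -> continuous (fun s => bd (c s)).
  move=> cc cb; apply: (@paste_cont _ _ n.+3 (fun j => [set s | c s j = 0])
    (fun j s => bar_simplex (del j g) (drop_coord j (c s)))).
  - move=> j; have h : continuous (fun s => c s j) := comp_cont cc (@pt_coord_cont R j).
    by have /continuous_closedP /(_ _ (@closed_eq R 0)) := h.
  - move=> j jn; have [dc _] := IH (del j g) ltac:(by rewrite size_del sg).
    exact: (comp_cont (comp_cont cc (@drop_coord_cont R j)) dc).
  - by move=> j s jn cs; apply: bdE => //; have [] := cb s.
  - by move=> s; have [_ [j jn cj]] := cb s; exists j.
have ex : exists F : pt -> X, continuous F /\ forall t, in_boundary n.+3 t -> F t = bd t.
  case: n IH sg bd sigE compat bdE bdc => [|n] IH sg bd sigE compat bdE bdc.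
    case: g sg sigE compat bdE => [//|a [//|b [//|c [|//]]]] _ _ _ bdE.
    have [||F Fc FE] := @extend_triangle R X (l (a^-1 * b)%g) (l (b^-1 * c)%g) (l (a^-1 * c)%g).
    - apply/phi_eq; [exact: loop_concat|by []|].
      by rewrite phi_concat// !phi_l mulgA mulgK.
    - by have [_ _ ->] := l_loop (a^-1 * b)%g; have [_ -> _] := l_loop (b^-1 * c)%g.
    exists F; split=> // t [st [j jn tj]]; have [F0 F1 F2] := FE t st.
    rewrite (bdE t j)//; case: j jn tj => [|[|[|//]]] _ tj.
    + by rewrite F0.
    + by rewrite F1.
    + by rewrite F2.
  have [F Fc FE] := @extend_simplex R n.+2 X bd isT
    (fun x => @pi_triv x n.+2 isT) bdc.
  by exists F.
have [Fc FE] : continuous (bar_simplex g) /\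
    forall t, in_boundary n.+3 t -> bar_simplex g t = bd t.
  rewrite sigE /filler.
  exact: (@xgetPex _ (cst x0) [set F | continuous F /\
    forall t, in_boundary n.+3 t -> F t = bd t] ex).
split=> // j t _ jn st tj; rewrite FE; first exact: bdE.
by split=> //; exists j.
Qed.

Lemma bar_simplex_cont g : (0 < size g)%N -> continuous (bar_simplex g).
Proof. by move=> g0; have [] := @bar_simplex_properties (size g).-1 g (esym (prednK g0)). Qed.

Lemma bar_simplex_face g j t : (1 < size g)%N -> (j < size g)%N ->
  in_simplex (size g) t -> t j = 0 ->
  bar_simplex g t = bar_simplex (del j g) (drop_coord j t).
Proof.
move=> g1; have [_] := @bar_simplex_properties (size g).-1 g (esym (prednK (ltnW g1))).
by rewrite prednK ?(ltnW g1)// => h jg st tj; apply: h => //; lia.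
Qed.

Lemma bar_simplex_insert0 g j t : (1 < size g)%N -> (j < size g)%N ->
  in_simplex (size g).-1 t ->
  bar_simplex g (insert0 j t) = bar_simplex (del j g) t.
Proof.
move=> g1 jg st; rewrite (@bar_simplex_face g j)// ?drop_insert0 ?insert0_self//.
by move: jg st; rewrite -{1 3}(prednK (ltnW g1)) => jg st; apply/in_simplex_insert0.
Qed.

Lemma bar_simplex_first_edge a b g (s : I) :
  bar_simplex (a :: b :: g) (seg (vtx R 0) (vtx R 1) (set_val s)) = l (a^-1 * b)%g s.
Proof.
elim: g => [|c g IH].
  by rewrite /bar_simplex /= /seg /vtx /= mulr0 add0r mulr1 val_clip.
rewrite (@bar_simplex_face _ 2)//=; last 2 first.
- apply: in_simplex_seg; [exact: in_simplex_vtx|exact: in_simplex_vtx|].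
  by rewrite I01_ge0 I01_le1.
- by rewrite /seg /vtx /= !mulr0 addr0.
rewrite !delS del0 -IH; congr (bar_simplex _ _); apply/funext => i.
by rewrite /drop_coord /seg /vtx /bump; case: i => [|[|i]] //=.
Qed.

Lemma bar_simplex_last_edge g a b (s : I) :
  bar_simplex (g ++ [:: a; b]) (seg (vtx R (size g)) (vtx R (size g).+1) (set_val s)) =
  l (a^-1 * b)%g s.
Proof.
elim: g => [|c g IH] /=; first exact: bar_simplex_first_edge.
have sz : size (g ++ [:: a; b]) = (size g).+2 by rewrite size_cat addn2.
rewrite (@bar_simplex_face _ 0)//= ?sz//; last 2 first.
- apply: in_simplex_seg; [exact: in_simplex_vtx|exact: in_simplex_vtx|].
  by rewrite I01_ge0 I01_le1.
- by rewrite /seg /vtx /= !mulr0 addr0.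
by rewrite del0 -IH.
Qed.

Lemma bar_simplex_vtx g j : (j < size g)%N -> bar_simplex g (vtx R j) = x0.
Proof.
have [n] := ubnP (size g); elim: n g j => // n IH g j; rewrite ltnS => gn jg.
case: g gn jg => // a [|b g] gn jg; first by rewrite /bar_simplex.
case: j jg => [|j] jg.
  rewrite (@bar_simplex_face _ (size g).+1)//=; last exact: in_simplex_vtx.
  rewrite (_ : drop_coord _ _ = vtx R 0); last first.
    by apply/funext => -[|i]; rewrite /drop_coord /vtx /bump ?addnS.
  by apply: IH; rewrite size_del//=.
rewrite (@bar_simplex_face _ 0)//=; last exact: in_simplex_vtx.
rewrite del0 (_ : drop_coord _ _ = vtx R j); last by apply/funext => i.
by apply: IH.
Qed.

End Simplices.

(** * Motion planners and Lebesgue numbers *)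

Section MotionPlanner.
Variables (R : realType) (X : topologicalType).
Local Notation I := (I01 R).

Lemma path_space_eval (S : topologicalType) (s : S -> path_space R X) :
  continuous s -> continuous (fun x : S * I => s x.1 x.2).
Proof.
move=> sc; pose f (x : S) : {compact-open, I -> X} := s x.
have fc : continuous f.
  have ic : continuous ((fun gamma : path_space R X => gamma : I -> X)
      : path_space R X -> {compact-open, I -> X}).
    exact: (@initial_continuous (path_space R X) {compact-open, I -> X}).
  exact: (comp_cont sc ic).
have := @continuous_uncurry S I X f _ (@I01_hausdorff R) fc _.
have -> : uncurry f = (fun x : S * I => s x.1 x.2) by apply/funext => -[].
apply.
- move=> r _; rewrite withinET; exists [set: I]; first exact: filterT.
  by split; [exact: I01_compact|exact: closedT].
- move=> x; exact: cts_fun.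
Qed.

(** The homotopy from the composite of the section with the end points to the
    inclusion moves the end points of the chosen path to [y]; its two
    coordinates, the first one reversed, are added to both ends of the path.
    The planner is made total by arbitrary values off [U i], hence the form of
    the continuity statement. *)
Lemma motion_planner k : secat_le R (@path_ends R X) k ->
  exists (U : 'I_k.+1 -> set (X * X)) (gamma : 'I_k.+1 -> X * X -> I -> X),
  [/\ forall i, open (U i), forall y, exists i, U i y,
      forall i (S : topologicalType) (c : S -> X * X), continuous c ->
        (forall s, U i (c s)) ->
        continuous (fun x : S * I => gamma i (c x.1) x.2) &
      forall i y, U i y -> gamma i y (clip 0) = y.1 /\ gamma i y (clip 1) = y.2].
Proof.
move=> [U [Uo Uc secs]].
pose spec i (gamma : X * X -> I -> X) :=
  (forall (S : topologicalType) (c : S -> X * X), continuous c ->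
        (forall s, U i (c s)) -> continuous (fun x : S * I => gamma (c x.1) x.2)) /\
  (forall y, U i y -> gamma y (clip 0) = y.1 /\ gamma y (clip 1) = y.2).
suff /choice [gamma gammaP] : forall i, exists gamma, spec i gamma.
  exists U, gamma; split => //.
  - move=> y; have : [set: X * X] y by [].
    by rewrite -Uc => -[i _ Uy]; exists i.
  - by move=> i; have [] := gammaP i.
  - by move=> i; have [] := gammaP i.
move=> i; have [s sc [H [Hc H0 H1 _]]] := secs i.
pose p (y : set_type (U i)) : I -> X := fun r => (H (y, clip (1 - set_val r))).1.
pose q (y : set_type (U i)) : I -> X := fun r => (H (y, r)).2.
pose sq (y : set_type (U i)) : I -> X := concat (s y) (q y).
pose g (y : set_type (U i)) : I -> X := concat (p y) (sq y).
have v1 : set_val (clip 1) = 1 :> R by rewrite clip_val// lexx ler01.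
have v0 : set_val (clip 0) = 0 :> R by rewrite clip_val// lexx ler01.
have gc : continuous (fun x : set_type (U i) * I => g x.1 x.2).
  have pc : continuous (fun x : set_type (U i) * I => p x.1 x.2).
    have h : continuous (fun x : set_type (U i) * I => (x.1, clip (1 - set_val x.2) : I)).
      apply: pair_cont; first exact: fst_cont.
      apply: (comp_cont _ (@clip_cont R)); apply: subr_cont; first exact: cst_cont.
      exact: (comp_cont (@snd_cont _ _) (@set_val_cont _ _)).
    exact: (comp_cont (comp_cont h Hc) (@fst_cont X X)).
  have qc : continuous (fun x : set_type (U i) * I => q x.1 x.2).
    have h : continuous (fun x : set_type (U i) * I => (x.1, x.2)).
      by apply: pair_cont; [exact: fst_cont|exact: snd_cont].
    exact: (comp_cont (comp_cont h Hc) (@snd_cont X X)).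
  have sqc : continuous (fun x : set_type (U i) * I => sq x.1 x.2).
    apply: (@concat_cont R _ X (fun y => s y : I -> X) q (path_space_eval sc) qc).
    by move=> y; rewrite /q H0.
  apply: (@concat_cont R _ X p sq pc sqc) => y.
  by rewrite /p /sq concat0 v1 subrr H0.
pose total (y : X * X) (r : I) : X :=
  if pselect (U i y) is left Uy then g (exist _ y (mem_set Uy)) r else y.1.
exists total; split=> [S c cc cU|y Uy].
  pose c' (x : S) : set_type (U i) := exist _ (c x) (mem_set (cU x)).
  have c'c : continuous c' by apply: into_set_type; exact: cc.
  have := @comp_cont _ _ _ (fun x : S * I => (c' x.1, x.2)) _ _ gc.
  move=> /(_ (pair_cont (comp_cont (@fst_cont _ _) c'c) (@snd_cont _ _))).
  suff -> : (fun x : S * I => total (c x.1) x.2) = (fun x => g (c' x.1) x.2) by [].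
  apply/funext => -[x r] /=; rewrite /total; case: pselect => [Ux|nU]; last by case: (nU (cU x)).
  by congr (g _ r); apply/val_inj.
rewrite /total; case: pselect => // Uy'; rewrite /g concat0 concat1 /sq concat1 /p /q v0 subr0.
by rewrite !H1 set_valE.
Qed.

End MotionPlanner.

Section Lebesgue.
Variable R : realType.
Local Notation pt := (pt R).

Definition pt_of_row n (v : 'rV[R]_n) : pt := cube_coord v.

Lemma pt_of_row_cont n : continuous (@pt_of_row n).
Proof. by apply: pt_continuous => i; exact: cube_coord_cont. Qed.

Lemma in_simplex_rowK n (t : pt) : in_simplex n t -> pt_of_row (\row_(i < n) t i) = t.
Proof.
move=> [_ tn _]; apply/funext => i; rewrite /pt_of_row /cube_coord.
by case: insubP => [j _ <-|]; rewrite ?mxE// -leqNgt => /tn.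
Qed.

Lemma in_simplex_closed n : closed [set t : pt | in_simplex n t].
Proof.
have -> : [set t : pt | in_simplex n t] =
   \bigcap_(i in [set: nat]) [set t : pt | 0 <= t i] `&`
   (\bigcap_(i in [set i | (n <= i)%N]) [set t : pt | t i = 0] `&`
   [set t : pt | \sum_(i < n) t i = 1]).
  apply/seteqP; split => t /=.
    by move=> [t0 tn t1]; split => [i _|]; [exact: t0|split => // i /tn].
  by move=> [t0 [tn t1]]; split; [move=> i; exact: t0|exact: tn|].
apply: closedI; [|apply: closedI].
- apply: closed_bigI => i _.
  by have /continuous_closedP /(_ _ (@closed_ge R 0)) := @pt_coord_cont R i.
- apply: closed_bigI => i _.
  by have /continuous_closedP /(_ _ (@closed_eq R 0)) := @pt_coord_cont R i.
- have sc : continuous (fun t : pt => \sum_(i < n) t i).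
    by apply: (@sumr_cont R pt n (fun i t => t i)) => i; exact: pt_coord_cont.
  by have /continuous_closedP /(_ _ (@closed_eq R 1)) := sc.
Qed.

Lemma lebesgue_number (J : Type) n (W : J -> set pt) :
  (forall j, open (W j)) -> (forall t, in_simplex n t -> exists j, W j t) ->
  exists2 e : R, 0 < e & forall t, in_simplex n t ->
    exists j, forall t', in_simplex n t' -> near_pt e t t' -> W j t'.
Proof.
move=> Wo Wcov; pose K : set 'rV[R]_n := [set v | in_simplex n (pt_of_row v)].
have Kc : compact K.
  apply: (@subclosed_compact _ _ (cube R n)).
  - by have /continuous_closedP /(_ _ (@in_simplex_closed n)) := @pt_of_row_cont n.
  - exact: cube_compact.
  - move=> v /= sv i; rewrite -cube_coordE; have [t0 _ _] := sv.
    by rewrite (t0 i) (in_simplex_le1 i sv).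
have /compact_near_coveringP /(_ R (0^'+)
  (fun e v => exists j, forall v', ball v e v' -> W j (pt_of_row v'))) := Kc.
have h : forall v, K v -> \forall v' \near v & e \near 0^'+,
    exists j, forall v'', ball v' e v'' -> W j (pt_of_row v'').
  move=> v /= sv; have [j Wv] := Wcov _ sv.
  have : nbhs v (@pt_of_row n @^-1` W j).
    by apply: pt_of_row_cont; apply: open_nbhs_nbhs; split.
  move=> /nbhs_ballP [d /= d0 vd].
  exists (ball v (d / 2), [set e | e < d / 2]) => /=.
    split; first by apply: nbhsx_ballx; rewrite divr_gt0.
    by apply: nbhs_right_lt; rewrite divr_gt0.
  move=> [v' e] /= [vv' ed]; exists j => v'' v'v''; apply: vd.
  rewrite [d]splitr; apply: ball_triangle vv' _.
  exact: le_ball (ltW ed) _ v'v''.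
move=> /(_ _ h) hn.
have [e [e0 eK]] : exists e : R, 0 < e /\ forall v, K v ->
    exists j, forall v', ball v e v' -> W j (pt_of_row v').
  near (0 : R)^'+ => e; exists e; split; first by [].
  by near: e; apply: filterS hn => e He v Kv; exact: He.
exists (e / 2); first by rewrite divr_gt0.
move=> t st; have [j Hj] := eK (\row_i t i) ltac:(by rewrite /K /= in_simplex_rowK).
exists j => t' st' tt'; rewrite -(in_simplex_rowK st'); apply: Hj.
split=> [//|i0 i]; rewrite !mxE /ball /=.
by apply: le_lt_trans (tt' i) _; lra.
Unshelve. all: by end_near. Qed.

End Lebesgue.

(** * Loop classes and the labels *)

Section Loops.
Variables (R : realType) (X : topologicalType) (x0 : X) (G : groupType).
Local Notation pt := (pt R).
Local Notation I := (I01 R).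
Variables (phi : (I -> X) -> G) (l : G -> I -> X).
Hypothesis phi_eq : forall p q, loop x0 p -> loop x0 q ->
  phi p = phi q <-> homotopic_rel R [set clip 0; clip 1] p q.
Hypothesis phi_concat : forall p q, loop x0 p -> loop x0 q ->
  phi (concat p q) = (phi p * phi q)%g.
Hypothesis l_loop : forall g, loop x0 (l g).
Hypothesis phi_l : forall g, phi (l g) = g.
Hypothesis pi_triv : forall (x : X) n, (2 <= n)%N -> pi_trivial R n x.

Local Notation bar_simplex := (bar_simplex x0 l).

Lemma val_clip0 : set_val (clip 0) = 0 :> R.
Proof. by rewrite clip_val// lexx ler01. Qed.

Lemma val_clip1 : set_val (clip 1) = 1 :> R.
Proof. by rewrite clip_val// lexx ler01. Qed.

(** A continuous family of loops at the base point is a homotopy relative to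
    the ends. All computations of classes below use such families and no
    reparametrization. *)
Lemma phi_family (K : I -> I -> X) :
  continuous (fun x : I * I => K x.1 x.2) ->
  (forall a, K a (clip 0) = x0) -> (forall a, K a (clip 1) = x0) ->
  phi (K (clip 0)) = phi (K (clip 1)).
Proof.
move=> Kc K0 K1; have sw : continuous (fun x : I * I => (x.2, x.1)).
  by apply: pair_cont; [exact: snd_cont|exact: fst_cont].
have Kl a : loop x0 (K a).
  by split=> //; exact: (@slice_cont R I X K a Kc).
apply/phi_eq => //; exists (fun x => K x.2 x.1); split=> //.
  exact: (comp_cont sw Kc).
by move=> x s [->|->]; rewrite ?K0 ?K1.
Qed.

Lemma phi_cst : phi (fun=> x0) = 1%g.
Proof.
have cl : loop x0 (fun _ : I => x0) by split => //; exact: cst_cont.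
have := phi_concat cl cl.
have -> : concat (fun=> x0) (fun=> x0) = (fun=> x0) :> (I -> X).
  by apply/funext => r; rewrite /concat; case: ifP.
by move=> e; apply: (mulgI (phi (fun=> x0))); rewrite -e mulg1.
Qed.

Definition spath (alpha : seq G) (s t : pt) : I -> X :=
  fun r => bar_simplex alpha (seg s t (set_val r)).

Lemma spath0 alpha s t : spath alpha s t (clip 0) = bar_simplex alpha s.
Proof. by rewrite /spath val_clip0 seg0. Qed.

Lemma spath1 alpha s t : spath alpha s t (clip 1) = bar_simplex alpha t.
Proof. by rewrite /spath val_clip1 seg1. Qed.

Lemma spath_family (S : topologicalType) alpha (s t : S -> pt) :
  (0 < size alpha)%N -> continuous s -> continuous t ->
  continuous (fun x : S * I => spath alpha (s x.1) (t x.1) x.2).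
Proof.
move=> a0 sc tc; have sgc := bar_simplex_cont phi_eq phi_concat l_loop phi_l pi_triv a0.
apply: (comp_cont _ sgc); apply: seg_cont.
- exact: (comp_cont (@fst_cont _ _) sc).
- exact: (comp_cont (@fst_cont _ _) tc).
- exact: (comp_cont (@snd_cont _ _) (@set_val_cont _ _)).
Qed.

Lemma snd_path_cont (S : topologicalType) (d : I -> X) : continuous d ->
  continuous (fun x : S * I => d x.2).
Proof. by move=> dc; exact: (comp_cont (@snd_cont _ _) dc). Qed.

Lemma seg_family (s t : pt) : continuous (fun a : I => seg s t (set_val a)).
Proof.
by apply: seg_cont; [exact: cst_cont|exact: cst_cont|exact: set_val_cont].
Qed.

(** Slide the intermediate point [w] of the path from the first vertex via [w]
    to [u] along the first edge: at the start the first leg is constant, at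
    the end it is the edge, which has class a^-1 b. *)
Lemma phi_change_first a b alpha u d :
  let al := a :: b :: alpha in
  continuous d -> bar_simplex al u = d (clip 0) -> d (clip 1) = x0 ->
  phi (concat (spath al (vtx R 0) u) d) =
  (a^-1 * b * phi (concat (spath al (vtx R 1) u) d))%g.
Proof.
move=> al dc ud d1; have sv := bar_simplex_vtx phi_eq phi_concat l_loop phi_l pi_triv.
pose w (r : I) := seg (vtx R 0) (vtx R 1) (set_val r).
pose inner (r : I) := concat (spath al (w r) u) d.
pose K (r : I) := concat (spath al (vtx R 0) (w r)) (inner r).
have wc : continuous w := @seg_family _ _.
have innerc : continuous (fun x : I * I => inner x.1 x.2).
  apply: (@concat_cont R I X (fun r => spath al (w r) u) (fun=> d)).
  - by apply: (@spath_family I al w (fun=> u)) => //; exact: cst_cont.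
  - exact: snd_path_cont.
  - by move=> r; rewrite spath1.
have Kc : continuous (fun x : I * I => K x.1 x.2).
  apply: (@concat_cont R I X (fun r => spath al (vtx R 0) (w r)) inner) => //.
  - by apply: (@spath_family I al (fun=> vtx R 0) w) => //; exact: cst_cont.
  - by move=> r; rewrite spath1 /inner concat0 spath0.
have K0 r : K r (clip 0) = x0 by rewrite /K concat0 spath0 sv.
have K1 r : K r (clip 1) = x0 by rewrite /K concat1 /inner concat1.
have innerl r : inner r (clip 0) = x0 -> loop x0 (inner r).
  move=> i0; split => //; last by rewrite /inner concat1.
  exact: (@slice_cont R I X inner r innerc).
have := phi_family Kc K0 K1; rewrite /K {1}/w val_clip0 seg0.
have -> : spath al (vtx R 0) (vtx R 0) = fun=> x0.
  by apply/funext => r; rewrite /spath segss sv.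
have -> : spath al (vtx R 0) (w (clip 1)) = l (a^-1 * b)%g.
  apply/funext => r; rewrite /w val_clip1 seg1 /spath.
  exact: (bar_simplex_first_edge phi_eq phi_concat l_loop phi_l pi_triv).
have e0 : inner (clip 0) = concat (spath al (vtx R 0) u) d by rewrite /inner /w val_clip0 seg0.
have e1 : inner (clip 1) = concat (spath al (vtx R 1) u) d by rewrite /inner /w val_clip1 seg1.
have l0 : loop x0 (inner (clip 0)) by apply: innerl; rewrite e0 concat0 spath0 sv.
have l1 : loop x0 (inner (clip 1)) by apply: innerl; rewrite e1 concat0 spath0 sv.
have lc : loop x0 (fun _ : I => x0) by split => //; exact: cst_cont.
rewrite (phi_concat lc l0) (phi_concat (l_loop _) l1).
by rewrite phi_cst mul1g phi_l e0 e1.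
Qed.

(** The same argument at the other end: slide the intermediate point along the
    last edge. *)
Lemma phi_change_last a b beta u p g :
  let be := beta ++ [:: a; b] in
  continuous p -> p (clip 0) = x0 -> continuous g -> p (clip 1) = g (clip 0) ->
  g (clip 1) = bar_simplex be u ->
  phi (concat p (concat g (spath be u (vtx R (size beta).+1)))) =
  (phi (concat p (concat g (spath be u (vtx R (size beta))))) * (a^-1 * b))%g.
Proof.
move=> be pc p0 gc pg gu; have sv := bar_simplex_vtx phi_eq phi_concat l_loop phi_l pi_triv.
have sbe : size be = (size beta).+2 by rewrite size_cat addn2.
pose w (r : I) := seg (vtx R (size beta)) (vtx R (size beta).+1) (set_val r).
pose inner (r : I) := concat g (spath be u (w r)).
pose outer (r : I) := concat p (inner r).
pose K (r : I) := concat (outer r) (spath be (w r) (vtx R (size beta).+1)).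
have wc : continuous w := @seg_family _ _.
have innerc : continuous (fun x : I * I => inner x.1 x.2).
  apply: (@concat_cont R I X (fun=> g) (fun r => spath be u (w r))).
  - exact: snd_path_cont.
  - by apply: (@spath_family I be (fun=> u) w); rewrite ?sbe//; exact: cst_cont.
  - by move=> r; rewrite spath0.
have outerc : continuous (fun x : I * I => outer x.1 x.2).
  apply: (@concat_cont R I X (fun=> p) inner) => //.
  - exact: snd_path_cont.
  - by move=> r; rewrite /inner concat0.
have Kc : continuous (fun x : I * I => K x.1 x.2).
  apply: (@concat_cont R I X outer (fun r => spath be (w r) (vtx R (size beta).+1))) => //.
  - by apply: (@spath_family I be w (fun=> vtx R (size beta).+1)); rewrite ?sbe//;
      exact: cst_cont.
  - by move=> r; rewrite /outer /inner !concat1 spath1 spath0.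
have K0 r : K r (clip 0) = x0 by rewrite /K concat0 /outer concat0.
have K1 r : K r (clip 1) = x0 by rewrite /K concat1 spath1 sv// sbe.
have outerl r : outer r (clip 1) = x0 -> loop x0 (outer r).
  move=> i0; split => //; last by rewrite /outer concat0.
  exact: (@slice_cont R I X outer r outerc).
have := phi_family Kc K0 K1; rewrite /K.
have -> : spath be (w (clip 1)) (vtx R (size beta).+1) = fun=> x0.
  by apply/funext => r; rewrite /w val_clip1 seg1 /spath segss sv// sbe.
have -> : spath be (w (clip 0)) (vtx R (size beta).+1) = l (a^-1 * b)%g.
  apply/funext => r; rewrite /w val_clip0 seg0 /spath.
  exact: (bar_simplex_last_edge phi_eq phi_concat l_loop phi_l pi_triv).
have e0 : outer (clip 0) = concat p (concat g (spath be u (vtx R (size beta)))).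
  by rewrite /outer /inner /w val_clip0 seg0.
have e1 : outer (clip 1) = concat p (concat g (spath be u (vtx R (size beta).+1))).
  by rewrite /outer /inner /w val_clip1 seg1.
have l0 : loop x0 (outer (clip 0)).
  by apply: outerl; rewrite e0 !concat1 spath1 sv// sbe.
have l1 : loop x0 (outer (clip 1)).
  by apply: outerl; rewrite e1 !concat1 spath1 sv// sbe.
have lc : loop x0 (fun _ : I => x0) by split => //; exact: cst_cont.
rewrite (phi_concat l0 (l_loop _)) (phi_concat l1 lc).
by rewrite phi_cst mulg1 phi_l -e0 -e1 => <-.
Qed.

End Loops.

Section Multiplicative.
Variables (A G : groupType) (f : {multiplicative A -> G}).

Lemma mult1 : f 1%g = 1%g.
Proof. by apply: (mulgI (f 1%g)); rewrite -gmulfM !mulg1. Qed.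

Lemma multV x : f (x^-1)%g = (f x)^-1%g.
Proof. by apply: (mulgI (f x)); rewrite -gmulfM !mulgV mult1. Qed.

End Multiplicative.

Lemma last_del (T : Type) x j (s : seq T) : (j.+1 < size s)%N ->
  last x (del j s) = last x s.
Proof.
move=> js; rewrite -!nth_last size_del ?(ltnW js)// nth_del; congr nth.
by rewrite /bump; case: (leqP j _) => h; lia.
Qed.

Section Semidirect.
Variables (A B G : groupType).
Variables (iA : {multiplicative A -> G}) (iB : {multiplicative B -> G}).
Hypothesis hG : semidirect iA iB.

(** The action (a, b).x = a x b^-1 of A x B on G is simply transitive;
    [factors] is the inverse of the orbit map of the identity. *)
Definition factors (x : G) : A * B :=
  xget (1%g, 1%g) [set p | x = (iA p.1 * (iB p.2)^-1)%g].

Lemma factorsE x : x = (iA (factors x).1 * (iB (factors x).2)^-1)%g.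
Proof.
have [_ _ _ _ AB] := hG; have [a [b xab]] := AB x.
apply: (@xgetPex _ (1%g, 1%g) [set p | x = (iA p.1 * (iB p.2)^-1)%g]).
by exists (a, b^-1)%g; rewrite /= multV invgK.
Qed.

Lemma factors_unique a b : factors (iA a * (iB b)^-1)%g = (a, b).
Proof.
have [iAi iBi _ AB1 _] := hG; have := factorsE (iA a * (iB b)^-1)%g.
case: (factors _) => [u v] /= e.
have h : iA (a^-1 * u)%g = iB (b^-1 * v)%g.
  rewrite !gmulfM !multV; apply: (mulgI (iA a)); rewrite !mulgA mulgV mul1g.
  by rewrite e mulgVK.
have : (range iA `&` range iB) (iA (a^-1 * u)%g).
  by split; [exists (a^-1 * u)%g|rewrite h; exists (b^-1 * v)%g].
rewrite AB1 /= => h1; move: (h1); rewrite h => h2.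
have -> : u = a.
  by apply: (mulgI (a^-1)%g); rewrite mulVg; apply: iAi; rewrite h1 mult1.
have -> // : v = b.
by apply: (mulgI (b^-1)%g); rewrite mulVg; apply: iBi; rewrite h2 mult1.
Qed.

Lemma factors_act a b x :
  factors (iA a * x * (iB b)^-1)%g = (a * (factors x).1, b * (factors x).2)%g.
Proof.
rewrite {1}(factorsE x) -factors_unique !gmulfM invgM !mulgA.
by [].
Qed.

End Semidirect.

Section Labels.
Variables (R : realType) (A B G : groupType).
Variables (iA : {multiplicative A -> G}) (iB : {multiplicative B -> G}).
Hypothesis hG : semidirect iA iB.
Variables (X : topologicalType) (x0 : X).
Local Notation pt := (pt R).
Local Notation I := (I01 R).
Local Notation P := (A * B)%type.
Variables (phi : (I -> X) -> G) (l : G -> I -> X).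
Hypothesis phi_eq : forall p q, loop x0 p -> loop x0 q ->
  phi p = phi q <-> homotopic_rel R [set clip 0; clip 1] p q.
Hypothesis phi_concat : forall p q, loop x0 p -> loop x0 q ->
  phi (concat p q) = (phi p * phi q)%g.
Hypothesis l_loop : forall g, loop x0 (l g).
Hypothesis phi_l : forall g, phi (l g) = g.
Hypothesis pi_triv : forall (x : X) n, (2 <= n)%N -> pi_trivial R n x.
Variables (k : nat) (U : 'I_k.+1 -> set (X * X)).
Variable gamma : 'I_k.+1 -> X * X -> I -> X.
Hypothesis U_open : forall i, open (U i).
Hypothesis U_cover : forall y, exists i, U i y.
Hypothesis gamma_cont : forall i (S : topologicalType) (c : S -> X * X),
  continuous c -> (forall s, U i (c s)) ->
  continuous (fun x : S * I => gamma i (c x.1) x.2).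
Hypothesis gamma_ends : forall i y, U i y ->
  gamma i y (clip 0) = y.1 /\ gamma i y (clip 1) = y.2.

Local Notation bar_simplex := (bar_simplex x0 l).
Local Notation spath := (spath x0 l).

Definition fstA (g : seq P) : seq G := [seq iA p.1 | p <- g].
Definition sndB (g : seq P) : seq G := [seq iB p.2 | p <- g].

Definition position (g : seq P) (t : pt) : X * X :=
  (bar_simplex (fstA g) t, bar_simplex (sndB g) t).

(** From the first vertex to [t] in the first coordinate, across by the motion
    planner, and back from [t] in the second coordinate. The return is to the
    last vertex, so that all edges are traversed forwards. *)
Definition tether (g : seq P) (i : 'I_k.+1) (t : pt) : I -> X :=
  concat (spath (fstA g) (vtx R 0) t)
    (concat (gamma i (position g t)) (spath (sndB g) t (vtx R (size g).-1))).

(** Multiplication by the first entry on the left and the inverse of the last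
    entry on the right makes the class of the tether independent of the
    vertices used. *)
Definition sheet (g : seq P) (i : 'I_k.+1) (t : pt) : P :=
  factors iA iB (head 1 (fstA g) * phi (tether g i t) * (last 1 (sndB g))^-1)%g.

Definition label (g : seq P) (i : nat) (t : pt) : option P :=
  if pselect (in_simplex (size g) t /\ U (inord i) (position g t))
  then Some (sheet g (inord i) t) else None.

Lemma position_cont g : (0 < size g)%N -> continuous (position g).
Proof.
move=> g0; apply: pair_cont;
  by apply: (bar_simplex_cont phi_eq phi_concat l_loop phi_l pi_triv); rewrite size_map.
Qed.

Lemma tether_family (S : topologicalType) g i (t : S -> pt) : (0 < size g)%N ->
  continuous t -> (forall s, U i (position g (t s))) ->
  continuous (fun x : S * I => tether g i (t x.1) x.2).
Proof.
move=> g0 tc tU; have pc := comp_cont tc (position_cont g0).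
have fc := spath_family phi_eq phi_concat l_loop phi_l pi_triv.
pose inner s := concat (gamma i (position g (t s))) (spath (sndB g) (t s) (vtx R (size g).-1)).
have ic : continuous (fun x : S * I => inner x.1 x.2).
  apply: (@concat_cont R S X (fun s => gamma i (position g (t s)))
    (fun s => spath (sndB g) (t s) (vtx R (size g).-1))).
  - exact: (gamma_cont pc tU).
  - by apply: (@fc S (sndB g) t (fun=> vtx R (size g).-1)); rewrite ?size_map//; exact: cst_cont.
  - by move=> s; have [_ ->] := gamma_ends (tU s); rewrite spath0.
apply: (@concat_cont R S X (fun s => spath (fstA g) (vtx R 0) (t s)) inner) => //.
- by apply: (@fc S (fstA g) (fun=> vtx R 0) t); rewrite ?size_map//; exact: cst_cont.
- by move=> s; rewrite spath1 /inner concat0; have [-> _] := gamma_ends (tU s).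
Qed.

Lemma tether0 g i t : (0 < size g)%N -> tether g i t (clip 0) = x0.
Proof.
move=> g0; rewrite /tether concat0 spath0.
by apply: (bar_simplex_vtx phi_eq phi_concat l_loop phi_l pi_triv); rewrite size_map.
Qed.

Lemma tether1 g i t : (0 < size g)%N -> tether g i t (clip 1) = x0.
Proof.
move=> g0; rewrite /tether !concat1 spath1.
by apply: (bar_simplex_vtx phi_eq phi_concat l_loop phi_l pi_triv); rewrite size_map prednK.
Qed.

Lemma label_mul h g i t :
  label (map (fun x => (h * x)%g) g) i t = omap (fun x => (h * x)%g) (label g i t).
Proof.
have eA : fstA (map (fun x => (h * x)%g) g) = map (fun x => (iA h.1 * x)%g) (fstA g).
  by rewrite /fstA -!map_comp; apply: eq_map => x /=; rewrite gmulfM.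
have eB : sndB (map (fun x => (h * x)%g) g) = map (fun x => (iB h.2 * x)%g) (sndB g).
  by rewrite /sndB -!map_comp; apply: eq_map => x /=; rewrite gmulfM.
have ep : position (map (fun x => (h * x)%g) g) t = position g t.
  by rewrite /position eA eB !bar_simplex_mul.
rewrite /label size_map ep; case: pselect => // -[st _] /=; congr Some.
have et : tether (map (fun x => (h * x)%g) g) (inord i) t = tether g (inord i) t.
  by rewrite /tether ep /spath eA eB !bar_simplex_mul size_map.
rewrite /sheet et eA eB.
have [g0|g0] := posnP (size g).
  by exfalso; move: st; rewrite g0 => -[_ _ /eqP]; rewrite big_ord0 eq_sym oner_eq0.
rewrite (_ : head _ _ = iA h.1 * head 1 (fstA g))%g; last by case: (g) g0.
rewrite (_ : last _ _ = iB h.2 * last 1 (sndB g))%g; last first.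
  by case: (g) g0 => // x g' _; rewrite /= last_map.
have -> (x y z u v : G) : (x * y * z * (u * v)^-1 = x * (y * z * v^-1) * u^-1)%g.
  by rewrite invgM !mulgA.
by rewrite factors_act.
Qed.

(** The tether of a face is the same loop, unless the first or the last vertex
    is removed; then [phi_change_first] or [phi_change_last] supplies the
    class of the missing edge, which the entries of [g] in [sheet] compensate
    for. *)
Lemma label_face g i j t : (j < size g)%N -> label g i (insert0 j t) = label (del j g) i t.
Proof.
move=> jg; have g0 : (0 < size g)%N by exact: leq_ltn_trans jg.
have sd : size (del j g) = (size g).-1 by rewrite size_del.
have simpE : in_simplex (size g) (insert0 j t) <-> in_simplex (size g).-1 t.
  by move: jg; rewrite -{1 2}(prednK g0) => jg; exact: in_simplex_insert0.
case: (ltnP 1 (size g)) => g1; last first.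
  have g1' : size g = 1%N by apply/eqP; rewrite eqn_leq g1.
  have nosimp : ~ in_simplex (size g).-1 t.
    by rewrite g1' => -[_ _ /eqP]; rewrite big_ord0 eq_sym oner_eq0.
  rewrite /label sd; case: pselect => [h|_] /=; first by case: (nosimp (simpE.1 h.1)).
  by case: pselect => // -[].
have delA : fstA (del j g) = del j (fstA g) by rewrite /fstA map_del.
have delB : sndB (del j g) = del j (sndB g) by rewrite /sndB map_del.
have sA : size (fstA g) = size g by rewrite size_map.
have sB : size (sndB g) = size g by rewrite size_map.
have insP := bar_simplex_insert0 phi_eq phi_concat l_loop phi_l pi_triv.
have sigA u : in_simplex (size g).-1 u ->
    bar_simplex (fstA g) (insert0 j u) = bar_simplex (fstA (del j g)) u.
  by move=> su; rewrite delA insP ?sA.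
have sigB u : in_simplex (size g).-1 u ->
    bar_simplex (sndB g) (insert0 j u) = bar_simplex (sndB (del j g)) u.
  by move=> su; rewrite delB insP ?sB.
rewrite /label sd; have [st|nst] := pselect (in_simplex (size g).-1 t); last first.
  case: pselect => [h|_] /=; first by case: (nst (simpE.1 h.1)).
  by case: pselect => // -[].
have ep : position g (insert0 j t) = position (del j g) t by rewrite /position sigA ?sigB.
rewrite ep; have [Ut|nU] := pselect (U (inord i) (position (del j g) t)); last first.
  by case: pselect => [[]|_] //=; case: pselect => // -[].
case: pselect => [?|] /=; last by case; split => //; exact/simpE.
case: pselect => [?|] /=; last by case.
congr Some; rewrite /sheet; congr factors.
set w := gamma (inord i) (position (del j g) t).
have [w0 w1] : w (clip 0) = bar_simplex (fstA (del j g)) t /\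
    w (clip 1) = bar_simplex (sndB (del j g)) t.
  exact: gamma_ends Ut.
have vtx0s : in_simplex (size g).-1 (vtx R 0) by apply: in_simplex_vtx; rewrite -subn1 subn_gt0.
have vtxms : in_simplex (size g).-1 (vtx R (size g).-2).
  by apply: in_simplex_vtx; case: (size g) g1 => [|[|n]].
have spA v : in_simplex (size g).-1 v -> spath (fstA g) (insert0 j v) (insert0 j t) =
    spath (fstA (del j g)) v t.
  move=> sv; apply/funext => r; rewrite /spath -insert0_seg sigA//.
  by apply: in_simplex_seg; rewrite // I01_ge0 I01_le1.
have spB v : in_simplex (size g).-1 v -> spath (sndB g) (insert0 j t) (insert0 j v) =
    spath (sndB (del j g)) t v.
  move=> sv; apply/funext => r; rewrite /spath -insert0_seg sigB//.
  by apply: in_simplex_seg; rewrite // I01_ge0 I01_le1.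
have wc : continuous w.
  have h := @gamma_cont (inord i) I (fun=> position (del j g) t) (@cst_cont _ _ _) (fun=> Ut).
  exact: (@slice_cont R I X (fun=> w) (clip 0) h).
have spc al u v : (0 < size al)%N -> continuous (spath al u v).
  move=> al0; have := @spath_family _ _ _ _ _ _ phi_eq phi_concat l_loop phi_l pi_triv
    I al (fun=> u) (fun=> v) al0 (@cst_cont _ _ _) (@cst_cont _ _ _) => h.
  exact: (@slice_cont R I X (fun=> spath al u v) (clip 0) h).
rewrite /tether ep -/w sd.
(* the contribution of the starting vertex *)
have first_part d : continuous d -> d (clip 0) = bar_simplex (fstA g) (insert0 j t) ->
    d (clip 1) = x0 ->
    (head 1 (fstA g) * phi (concat (spath (fstA g) (vtx R 0) (insert0 j t)) d) =
     head 1 (fstA (del j g)) *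
       phi (concat (spath (fstA (del j g)) (vtx R 0) t) d))%g.
  move=> dc d0 d1; case: (posnP j) => [j0|j_gt0]; last first.
    rewrite -[in LHS](_ : insert0 j (vtx R 0) = vtx R 0); last first.
      by rewrite insert0_vtx /bump leqNgt j_gt0.
    rewrite spA// delA; congr (_ * _)%g.
    by case: (fstA g) (j) j_gt0 => [|a al] [].
  subst j; rewrite -(spA _ vtx0s) insert0_vtx delA /bump leqnn addn0.
  move: sA d0; case: (fstA g) => [|a [|b al]] sA d0.
  - by move: g0; rewrite -sA.
  - by move: g1; rewrite -sA.
  rewrite (phi_change_first phi_eq phi_concat l_loop phi_l pi_triv)//.
  by rewrite del0 /= !mulgA mulgV mul1g.
(* the contribution of the final vertex *)
have last_part p : continuous p -> p (clip 0) = x0 -> p (clip 1) = w (clip 0) ->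
    (phi (concat p (concat w (spath (sndB g) (insert0 j t) (vtx R (size g).-1)))) *
       (last 1 (sndB g))^-1 =
     phi (concat p (concat w (spath (sndB (del j g)) t (vtx R (size g).-2)))) *
       (last 1 (sndB (del j g)))^-1)%g.
  move=> pc p0 p1; have gm : (size g).-1 = (size g).-2.+1.
    by rewrite prednK// -subn1 subn_gt0.
  rewrite -(spB _ vtxms) insert0_vtx /bump delB.
  case: (leqP j (size g).-2) => jm.
    by rewrite add1n -gm last_del// sB; move: gm g1 jm; lia.
  have {}jm : j = (size g).-1 by move: gm jg jm; lia.
  rewrite add0n jm gm.
  have [beta [a [b eB]]] : exists beta a b, sndB g = beta ++ [:: a; b].
    move: g1; rewrite -sB; case/lastP: (sndB g) => [//|s b].
    case/lastP: s => [//|s a] _; exists s, a, b.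
    by rewrite -!cats1 -catA.
  have sbeta : size beta = (size g).-2.
    by have := congr1 size eB; rewrite sB size_cat => ->; rewrite addn2.
  have wj : w (clip 1) = bar_simplex (sndB g) (insert0 j t) by rewrite w1 sigB.
  rewrite -sbeta eB in wj *.
  rewrite (phi_change_last phi_eq phi_concat l_loop phi_l pi_triv)//; last first.
    by rewrite wj; congr (bar_simplex _ (insert0 _ _)); rewrite jm sbeta; exact: gm.
  have -> : del (size beta).+1 (beta ++ [:: a; b]) = rcons beta a.
    rewrite /del -addn1 takeD take_size_cat// drop_size_cat// cats1.
    by rewrite -addSn addn1 drop_oversize ?cats0// size_cat addn2.
  by rewrite last_rcons last_cat /= -!mulgA mulgV mulg1.
have vertA al v : (v < size al)%N -> bar_simplex al (vtx R v) = x0.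
  exact: (bar_simplex_vtx phi_eq phi_concat l_loop phi_l pi_triv).
have dsA : size (fstA (del j g)) = (size g).-1 by rewrite delA size_del sA.
have ds0 : (0 < (size g).-1)%N by rewrite -subn1 subn_gt0.
have lastc : continuous (spath (sndB g) (insert0 j t) (vtx R (size g).-1)).
  by apply: spc; rewrite sB.
have firstc : continuous (spath (fstA (del j g)) (vtx R 0) t).
  by apply: spc; rewrite dsA.
rewrite first_part.
- rewrite -!mulgA; congr (_ * _)%g; apply: last_part => //.
  + by rewrite spath0 vertA// dsA.
  + by rewrite spath1 w0.
- by apply: concat_path_cont => //; rewrite spath0 w1 sigB.
- by rewrite concat0 w0 sigA.
- by rewrite !concat1 spath1 vertA// sB prednK.
Qed.

(** On a ball inside the part over [U i], two points are joined by a segment,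
    and the tethers along it form a homotopy. *)
Lemma label_small g : (0 < size g)%N ->
  exists2 e : R, 0 < e & forall t, in_simplex (size g) t ->
    exists i p, (i <= k)%N /\
      forall t', in_simplex (size g) t' -> near_pt e t t' -> label g i t' = Some p.
Proof.
move=> g0; have pc := position_cont g0.
have [|t _|e e0 He] := @lebesgue_number R 'I_k.+1 (size g)
    (fun i => position g @^-1` U i).
- by move=> i; move/continuousP: pc; apply.
- exact: U_cover.
exists e => // t st; have [i Hi] := He t st.
exists i, (sheet g i t); rewrite -ltnS ltn_ord; split => // t' st' tt'.
have near_seg a : 0 <= a <= 1 -> near_pt e t (seg t t' a).
  move=> /andP[a0 a1] j; apply: le_trans (tt' j).
  rewrite /seg (_ : t j - _ = a * (t j - t' j)); last by ring.
  by rewrite normrM ger0_norm// ler_piMl.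
have Useg (a : I) : U i (position g (seg t t' (set_val a))).
  have a01 : 0 <= (set_val a : R) <= 1 by rewrite I01_ge0 I01_le1.
  by apply: Hi; [exact: in_simplex_seg|exact: near_seg].
rewrite /label inord_val; case: pselect => [?|] /=; last first.
  by case; split => //; exact: Hi.
congr Some; rewrite /sheet; congr factors; congr (_ * _ * _)%g.
have := phi_family phi_eq (K := fun a => tether g i (seg t t' (set_val a)))
  (tether_family g0 (@seg_family R t t') Useg)
  (fun a => tether0 i _ g0) (fun a => tether1 i _ g0).
by rewrite val_clip0 val_clip1 seg0 seg1.
Qed.

Lemma cohomology_vanishes n (M : gmodule P) : (k < n)%N -> cohomology_trivial M n.
Proof.
apply: (@cohomology_trivial_of_labels R P k label).
- exact: label_mul.
- exact: label_face.
- exact: label_small.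
Qed.

End Labels.

Theorem corollary1p3 (R : realType) (A B G : groupType)
    (iA : {multiplicative A -> G}) (iB : {multiplicative B -> G})
    (hG : semidirect iA iB)
    (X : topologicalType) (hX : eilenberg_maclane R G X) :
  (cd (A * B)%type <= TC R X)%E.
Proof.
have [_ _ [x0 [phi [phi_eq phi_concat phi_surj]]] pi_triv] := hX.
apply/ereal_infP => _ [k /= k_sec <-].
apply: ge_ereal_inf; exists ((k%:R)%:E) => //; exists k => // n kn M.
have /choice [l lP] : forall g, exists p, loop x0 p /\ phi p = g.
  by move=> g; have [p] := phi_surj g; exists p.
have [U [gamma [U_open U_cover gamma_cont gamma_ends]]] := motion_planner k_sec.
apply: (cohomology_vanishes (l := l) hG phi_eq phi_concat _ _ pi_triv U_open U_cover
  gamma_cont gamma_ends kn).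
- by move=> g; have [] := lP g.
- by move=> g; have [] := lP g.
Qed.
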